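(* The set $C(\lambda)_{h_{top}=\infty}$ of all maps $f\in C(\lambda)$ with infinite topological entropy is a dense $G_\delta$ subset of the metric space $(C(\lambda),\rho)$.
   Context: $\lambda$ is the Lebesgue measure on $[0,1]$, $\mathcal B$ the Borel $\sigma$-algebra of $[0,1]$. $C(\lambda)$ is the set of all continuous maps $f\colon[0,1]\to[0,1]$ with $\lambda(A)=\lambda(f^{-1}(A))$ for all $A\in\mathcal B$, equipped with the complete metric $\rho(f,g)=\sup_{x\in[0,1]}|f(x)-g(x)|$. *)

(* Defs.v *)
From HB Require Import structures.
From mathcomp Require Import all_boot all_order all_algebra finmap.
From mathcomp Require Import all_classical all_reals all_analysis.
From mathcomp Require Import lra.

Set Implicit Arguments.
Unset Strict Implicit.
Unset Printing Implicit Defensive.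

Import Order.TTheory GRing.Theory Num.Theory.
Import numFieldNormedType.Exports.

Local Open Scope classical_set_scope.
Local Open Scope ring_scope.

(* Bowen's definition, meant for continuous f on a compact metric space T:
   h(f) = lim_(eps -> 0+) limsup_n (1 / n) log s_n(eps), with s_n(eps) the
   maximal cardinality of an (n, eps)-separated set. The limit exists because
   s_n(eps) is nonincreasing in eps; the value may be +oo. *)
Section topological_entropy.
Context {R : realType} {T : metricType R}.
Implicit Types (f : T -> T) (n : nat) (eps : R).

(* d_n(x, y) = max_(0 <= i < n) d(f^i x, f^i y); the unit 0 of the iterated
   maximum is harmless since distances are nonnegative. *)
Definition bowen_dist f n (x y : T) : R :=
  \big[Num.max/0]_(i < n) mdist (iter i f x) (iter i f y).

Definition separated f n eps (E : {fset T}) : Prop :=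
  forall x y, x \in E -> y \in E -> x != y -> eps < bowen_dist f n x y.

Definition max_separated f n eps : \bar R :=
  ereal_sup [set (#|` E|%:R)%:E | E in [set E | separated f n eps E]].

Definition entropy_at f eps : \bar R :=
  limn_esup (fun n => ((n%:R)^-1)%:E * lne (max_separated f n eps))%E.

Definition topological_entropy f : \bar R :=
  lim (entropy_at f eps @[eps --> 0^'+]).

End topological_entropy.

Definition unit_interval (R : realType) : Type := set_type (`[0, 1] : set R).

Section unit_interval.
Context {R : realType}.
Notation I := (unit_interval R).

(* Topology and balls are those induced by the inclusion in R. *)
HB.instance Definition _ := PseudoMetric.copy I (set_type (`[0, 1] : set R)).

Let dist (x y : I) : R := `|set_val x - set_val y|.

Let dist_ge0 x y : 0 <= dist x y. Proof. exact: normr_ge0. Qed.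

Let dist_positivity x y : dist x y = 0 -> x = y.
Proof. by move/normr0_eq0/subr0_eq; exact: val_inj. Qed.

Let ballE (x : I) e : ball x e = [set y | dist x y < e].
Proof. by []. Qed.

HB.instance Definition _ :=
  @PseudoMetric_isMetric.Build R I dist dist_ge0 dist_positivity ballE.

Definition lambda01 (A : set I) : \bar R := lebesgue_measure (set_val @` A).

Definition borel01 : set (set I) := <<s open >>.

End unit_interval.

(* C(lambda): the continuous self-maps of [0, 1] preserving Lebesgue measure.
   The topology of this type is the one of the metric rho defined below. *)
Record Clambda (R : realType) := MkClambda {
  Clambda_fun :> unit_interval R -> unit_interval R ;
  Clambda_continuous : continuous Clambda_fun ;
  Clambda_preserving : forall A, borel01 A ->
    lambda01 A = lambda01 (Clambda_fun @^-1` A) }.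

Section Clambda_metric.
Context {R : realType}.
Notation C := (Clambda R).

Lemma Clambda_inj (f g : C) : (forall x, f x = g x) -> f = g.
Proof.
case: f g => f cf pf [g cg pg] /= /funext fg; move: cf pf cg pg.
by rewrite fg => *; congr MkClambda; exact: Prop_irrelevance.
Qed.

HB.instance Definition _ := gen_eqMixin C.
HB.instance Definition _ := gen_choiceMixin C.

Definition rho (f g : C) : R :=
  sup [set `|set_val (f x) - set_val (g x)| | x in [set: unit_interval R]].

Let point0 : unit_interval R.
Proof.
by exists 0; rewrite inE /= in_itv /= lexx ler01.
Qed.

Let val01 (x : unit_interval R) : 0 <= set_val x <= 1.
Proof. by have := valP x; rewrite inE /= in_itv. Qed.

Let le_rho (f g : C) x : `|set_val (f x) - set_val (g x)| <= rho f g.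
Proof.
apply: sup_ubound; last by exists x.
exists 1 => _ [y _ <-]; have /andP[f0 f1] := val01 (f y).
have /andP[g0 g1] := val01 (g y).
by rewrite ler_norml; apply/andP; split; lra.
Qed.

Let rho_le (f g : C) e :
  (forall x, `|set_val (f x) - set_val (g x)| <= e) -> rho f g <= e.
Proof.
move=> fge; apply: ge_sup => [|_ [x _ <-]//].
by exists `|set_val (f point0) - set_val (g point0)|, point0.
Qed.

Let rhoxx f : rho f f = 0.
Proof.
apply/eqP; rewrite eq_le (le_trans _ (le_rho f f point0)) ?andbT//.
by apply: rho_le => x; rewrite subrr normr0.
Qed.

Let rho_positivity f g : rho f g = 0 -> f = g.
Proof.
move=> fg0; apply: Clambda_inj => x; apply: val_inj; apply: subr0_eq.
by apply/eqP; have := le_rho f g x; rewrite fg0 normr_le0.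
Qed.

Let rho_sym f g : rho f g = rho g f.
Proof.
by apply/eqP; rewrite eq_le; apply/andP; split; apply: rho_le => x;
  rewrite distrC le_rho.
Qed.

Let rho_triangle g f h : rho f h <= rho f g + rho g h.
Proof.
apply: rho_le => x; rewrite -(subrKA (set_val (g x))).
by rewrite (le_trans (ler_normD _ _))// lerD ?le_rho.
Qed.

HB.instance Definition _ :=
  @isMetric.Build R C rho rhoxx rho_positivity rho_sym rho_triangle.

End Clambda_metric.

(* Main.v *)
Require Import Defs.
From mathcomp Require Import all_boot all_order all_algebra finmap.
From mathcomp Require Import all_classical all_reals all_analysis borel_hierarchy.
From mathcomp Require Import measurable_realfun zify ring lra.

(** Two facts carry the proof: infinite entropy is witnessed by horseshoes that
    survive small perturbations, and every measure-preserving map can be folded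
    over itself at infinitely many small scales around a fixed point.

    G-delta. The maps of infinite entropy are the common points of the interiors
    of the sets {h >= ln (k + 2)}, provided that a map f of infinite entropy is
    interior to each of them ([robust_entropy]). Entropy is lower semicontinuous
    on interval maps by a theorem of Misiurewicz, but as f has infinite entropy,
    constant factors may be lost in all exponential rates, and a rough count is
    enough. Cut [0, 1] into N equal pieces and follow intervals: L is replaced by
    f(L) /\ P, for each piece P that f(L) meets. Unless P is one of at most four
    pieces, f(L) covers P and both its neighbours, P is crossed, and the
    interval followed becomes the whole of P. Words of pieces are thus cut into
    independent parts at the crossed pieces. If for all l and s there were at
    most B ^ s words of length s that lead from the piece l to a crossing of l,
    then splitting words at the first and the last crossing of one piece after
    the other would bound the number of all words of length n by a polynomial
    times B ^ n ([words_bound]), and the entropy of f at scale 1 / N by ln (4 B)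
    ([few_returns_entropy_le]). So there are l and s with more than (2 C) ^ s
    such words. More than C ^ s of them agree modulo 2 at all times
    ([parity_class]), so that distinct ones are at some time a full piece
    apart. Pulled back along these words ([pull_back]), l contains more than C ^ s
    intervals that f ^ s maps over l and its two neighbours. The neighbours and
    the gaps are margins: the same intervals are a horseshoe for every map
    close to f, whose entropy is then at least ln C ([horseshoe_entropy]).

    Density. A measure-preserving f has a fixed point c in ]0, 1[
    ([interior_fixed_point]). Let Z be the map that is the identity off
    [c - d, c + d] and a zigzag with three full laps on that window; it preserves
    the measure ([fold_line_ray]). As f does not decrease lengths, f maps the
    window over one of its two halves ([preserving_expands]), hence f \o Z ^ (k + 1)
    has a horseshoe with 2 ^ k branches in that half, off the middle third of
    the window. So f is composed successively with the iterated folds of windows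
    of radii d_0, d_1, ..., each window lying inside the middle third of the
    previous one: later folds do not touch the horseshoes of the earlier ones.
    The radii are chosen so that the map of stage k sends its window to within
    e / 2 ^ k of c. Off c the stages are eventually constant, so that they
    converge to a map that is within 2 e of f, continuous ([limit_continuous]),
    measure-preserving, as it differs from stage k only on a set of measure
    2 d_k ([limit_preserving]), and has horseshoes with 2 ^ k branches for all
    k ([limit_horseshoe]). *)

Set Implicit Arguments.
Unset Strict Implicit.
Unset Printing Implicit Defensive.

Import Order.TTheory GRing.Theory Num.Theory.
Import numFieldNormedType.Exports.

(** * Counting words in a covering graph *)

Lemma leq_expn2r e m n : m <= n -> m ^ e <= n ^ e.
Proof. by case: e => // e mn; rewrite leq_exp2r. Qed.

(** States of type T, with letters in 'I_N, abstract the intervals followed by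
    an interval map: a transition along a full letter j forgets its source and
    leads to the state A j, and all but D of the transitions available from a
    state are full. *)
Section Words.
Variables (N D : nat) (T : Type) (A : 'I_N -> T) (step : T -> 'I_N -> T).
Variables (alive full : T -> pred 'I_N).
Hypothesis full_alive : forall L j, full L j -> alive L j.
Hypothesis full_step : forall L j, full L j -> step L j = A j.
Hypothesis few_partial :
  forall L, #|[pred j | alive L j && ~~ full L j]| <= D.

Fixpoint words (P : T -> pred 'I_N) n L : seq (seq 'I_N) :=
  if n is m.+1 then
    flatten [seq map (cons j) (words P m (step L j)) | j <- enum 'I_N & P L j]
  else [:: [::]].

Definition allow (S : {set 'I_N}) L : pred 'I_N :=
  fun j => alive L j && (full L j ==> (j \in S)).

(** These words have length n + 1: their last letter is the full letter l. *)
Definition arrivals l n L :=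
  count (fun w => full (foldl step L w) l) (words alive n L).

Lemma count_words (a : pred (seq 'I_N)) P n L :
  count a (words P n.+1 L) =
  \sum_(j | P L j) count (fun w => a (j :: w)) (words P n (step L j)).
Proof.
rewrite /= count_flatten sumnE !big_map big_filter big_enum_cond /=.
by apply: eq_bigr => j _; rewrite count_map; apply: eq_count.
Qed.

Lemma size_wordsS P n L :
  size (words P n.+1 L) = \sum_(j | P L j) size (words P n (step L j)).
Proof.
by rewrite -count_predT count_words; apply: eq_bigr => j _; rewrite -count_predT.
Qed.

Lemma arrivalsS l n L :
  arrivals l n.+1 L = \sum_(j | alive L j) arrivals l n (step L j).
Proof. by rewrite /arrivals count_words. Qed.

Lemma mem_words P n L w : w \in words P n L -> size w = n.
Proof.
elim: n L w => [|n IH] L w /=; first by rewrite inE => /eqP ->.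
by case/flatten_mapP => j _ /mapP[v /IH <- ->].
Qed.

Lemma uniq_words P n L : uniq (words P n L).
Proof.
elim: n L => [//|n IH] L /=; set s := [seq j <- _ | _].
have : uniq s by rewrite filter_uniq // enum_uniq.
elim: s => [//|j s IHs] /= /andP[js us].
rewrite cat_uniq map_inj_uniq ?IH; last by move=> ? ? [].
rewrite IHs // andbT /=.
apply/hasPn => w /flatten_mapP[k ks /mapP[v _ ->]].
by apply/negP => /mapP[u _ [kj _]]; case/negP: js; rewrite -kj.
Qed.

Lemma sum_allowU1 (S : {set 'I_N}) l L (G : 'I_N -> nat) : l \notin S ->
  \sum_(j | allow (l |: S) L j) G j =
  full L l * G l + \sum_(j | allow S L j) G j.
Proof.
move=> lS; rewrite (bigID (fun j => full L j && (j == l))) /=; congr (_ + _).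
  case: (boolP (full L l)) => fl; last first.
    rewrite mul0n big_pred0 // => j; apply/negbTE/negP => /andP[_ /andP[fj /eqP jl]].
    by rewrite -jl fj in fl.
  rewrite mul1n (big_pred1 l) // => j; rewrite /allow.
  case: (eqVneq j l) => [->|/negbTE jl]; last by rewrite !andbF /= jl.
  by rewrite setU11 fl full_alive //= eqxx.
apply: eq_bigl => j; rewrite /allow !inE.
case: (alive L j) => //=; case: (boolP (full L j)) => //= fj.
by case: eqP => [->|] //=; rewrite ?(negbTE lS) ?andbT.
Qed.

(** A word that uses the full letter l splits at its first use of it: before it
    the full letters lie in S, and the rest starts afresh from A l. *)
Lemma first_arrival (S : {set 'I_N}) l n L : l \notin S ->
  size (words (allow (l |: S)) n L) <=
  size (words (allow S) n L) +
  \sum_(a < n) size (words (allow S) a L) *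
               size (words (allow (l |: S)) (n - a.+1) (A l)).
Proof.
move=> lS; elim: n L => [|n IH] L; first by rewrite big_ord0.
rewrite size_wordsS sum_allowU1 // size_wordsS big_ord_recl /= mul1n subn1 /=.
set u := size (words _ n (A l)).
have le1 : full L l * size (words (allow (l |: S)) n (step L l)) <= u.
  by case: (boolP (full L l)) => [/full_step ->|_]; rewrite ?mul1n ?mul0n.
have le2 : \sum_(j | allow S L j) size (words (allow (l |: S)) n (step L j)) <=
  \sum_(j | allow S L j) size (words (allow S) n (step L j)) +
  \sum_(a < n) size (words (allow S) a.+1 L) *
    size (words (allow (l |: S)) (n - a.+1) (A l)).
  apply: leq_trans (@leq_sum _ _ (allow S L) _ _ (fun j _ => IH (step L j))) _.
  rewrite big_split /= leq_add2l exchange_big /=; apply: leq_sum => a _.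
  by rewrite size_wordsS big_distrl.
rewrite addnCA; exact: leq_add le1 le2.
Qed.

(** The same splitting at the last use of the full letter l. *)
Lemma last_arrival (S : {set 'I_N}) l n L : l \notin S ->
  size (words (allow (l |: S)) n L) <=
  size (words (allow S) n L) +
  \sum_(b < n) arrivals l b L * size (words (allow S) (n - b.+1) (A l)).
Proof.
move=> lS; elim: n L => [|n IH] L; first by rewrite big_ord0.
have le1 : \sum_(j | allow (l |: S) L j) size (words (allow S) n (step L j)) <=
    size (words (allow S) n.+1 L) + arrivals l 0 L * size (words (allow S) n (A l)).
  rewrite sum_allowU1 // size_wordsS addnC leq_add2l /arrivals /= addn0.
  by case: (boolP (full L l)) => [/full_step ->|_]; rewrite ?mul1n ?mul0n.
have le2 : \sum_(j | allow (l |: S) L j)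
      \sum_(b < n) arrivals l b (step L j) * size (words (allow S) (n - b.+1) (A l))
    <= \sum_(b < n) arrivals l b.+1 L * size (words (allow S) (n - b.+1) (A l)).
  rewrite exchange_big /=; apply: leq_sum => b _.
  rewrite -big_distrl /= leq_mul2r; apply/orP; right.
  rewrite arrivalsS [leqRHS](bigID (allow (l |: S) L)) /=.
  apply: leq_trans (leq_addr _ _); apply: eq_leq; apply: eq_bigl => j.
  by rewrite /allow andbA andbb.
rewrite size_wordsS.
apply: leq_trans (@leq_sum _ _ (allow (l |: S) L) _ _ (fun j _ => IH (step L j))) _.
rewrite big_split /= big_ord_recl /= subn1 /= addnA.
exact: leq_add le1 le2.
Qed.

(** By induction on S, one full letter l being added at a time. Words from A l are
    cut at their last use of l, and the part before it is counted by the
    hypothesis on returns; words from other states are then cut at their first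
    use of l. Each cut costs a sum over its position, hence a power of n + 1, but
    does not change the exponential rate. *)
Lemma words_bound B : 0 < B -> D <= B ->
  (forall l n, arrivals l n (A l) <= B ^ n.+1) ->
  forall S : {set 'I_N}, exists p, forall n L,
    size (words (allow S) n L) <= n.+1 ^ p * B ^ n.
Proof.
move=> B0 DB arrB S; move: {2}#|S| (leqnn #|S|) => k.
elim: k S => [|k IH] S Sk.
  move: Sk; rewrite leqn0 cards_eq0 => /eqP ->; exists 0 => n L.
  rewrite expn0 mul1n; elim: n L => [//|n IHn] L.
  rewrite size_wordsS expnS.
  apply: leq_trans (@leq_sum _ _ _ _ _ (fun j _ => IHn (step L j))) _.
  rewrite sum_nat_const leq_mul2r; apply/orP; right.
  apply: leq_trans DB; apply: leq_trans (few_partial L); apply: eq_leq.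
  by apply: eq_card => j; rewrite !inE /allow unfold_in inE implybF.
have [/eqP S0|[l lS]] := set_0Vmem S.
  by apply: IH; rewrite (eqP S0) cards0.
have [|p Wp] := IH (S :\ l).
  by move: Sk; rewrite (cardsD1 l) lS add1n ltnS.
have lS' : l \notin S :\ l by rewrite !inE eqxx.
have WA n : size (words (allow S) n (A l)) <= n.+1 ^ p.+1 * B ^ n.
  have := last_arrival n (A l) lS'; rewrite finset.setD1K //.
  move=> /leq_trans; apply.
  apply: leq_trans
    (_ : n.+1 ^ p * B ^ n + \sum_(b < n) n.+1 ^ p * B ^ n <= _).
    apply: leq_add => //; apply: leq_sum => b _.
    apply: leq_trans (leq_mul (arrB _ _) (Wp _ _)) _.
    rewrite mulnCA -expnD; apply: leq_mul.
      by apply: leq_expn2r; lia.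
    by rewrite leq_pexp2l //; have := ltn_ord b; lia.
  by rewrite sum_nat_const card_ord -mulSn mulnA expnS.
exists (2 * p + 2) => n L.
have := first_arrival n L lS'; rewrite finset.setD1K //.
move=> /leq_trans; apply.
apply: leq_trans
  (_ : n.+1 ^ (2 * p + 1) * B ^ n +
       \sum_(b < n) n.+1 ^ (2 * p + 1) * B ^ n <= _).
  apply: leq_add; first apply: leq_trans (Wp _ _) _.
    by rewrite leq_mul2r leq_pexp2l ?orbT //; clear; lia.
  apply: leq_sum => a _; apply: leq_trans (leq_mul (Wp _ _) (WA _)) _.
  rewrite mulnACA -expnD; apply: leq_mul; last first.
    by rewrite leq_pexp2l //; have := ltn_ord a; lia.
  rewrite (_ : 2 * p + 1 = p + p.+1); last by lia.
  by rewrite expnD; apply: leq_mul; apply: leq_expn2r => //; have := ltn_ord a; lia.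
rewrite sum_nat_const card_ord -mulSn mulnA.
by rewrite (_ : 2 * p + 2 = (2 * p + 1).+1) ?expnS //; lia.
Qed.

End Words.

(** Pigeonhole over the 2 ^ n parity patterns. *)
Lemma parity_class N n m (s : seq (seq 'I_N)) :
  (forall w, w \in s -> size w = n) -> m * 2 ^ n < size s ->
  exists p : seq bool, m < count (fun w => [seq odd (val j) | j <- w] == p) s.
Proof.
move=> sn lt_s.
have [/hasP[/= p _ mp]|nex] := boolP (has (fun p : n.-tuple bool => m <
    count (fun w => [seq odd (val j) | j <- w] == p) s) (enum {: n.-tuple bool})).
  by exists p.
suff : size s <= m * 2 ^ n by rewrite leqNgt lt_s.
have -> : size s = \sum_(p : n.-tuple bool)
    count (fun w => [seq odd (val j) | j <- w] == p) s.
  rewrite -[LHS]sum1_size.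
  under [RHS]eq_bigr do rewrite -sum1_count big_mkcond /=.
  rewrite exchange_big /=; apply: eq_big_seq => w ws.
  have sw : size [seq odd (val j) | j <- w] == n by rewrite size_map sn.
  by rewrite -big_mkcond (big_pred1 (Tuple sw)).
apply: leq_trans (_ : \sum_(p : n.-tuple bool) m <= _).
  by apply: leq_sum => p _; rewrite leqNgt (hasPn nex) // mem_enum.
by rewrite sum_nat_const card_tuple card_bool mulnC.
Qed.

(** (n + 1) ^ p <= (n + p) ^_ p = p! 'C(n + p, p) <= p! 2 ^ (n + p). *)
Lemma poly_leq_exp p : exists K, forall n, n.+1 ^ p <= K * 2 ^ n.
Proof.
exists (p`! * 2 ^ p) => n; rewrite -mulnA -expnD.
apply: leq_trans (_ : (n + p) ^_ p <= _).
  elim: p => [|p IH]; first by rewrite ffactn0.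
  rewrite addnS expnS.
  have -> : (n + p).+1 ^_ p.+1 = (n + p).+1 * (n + p) ^_ p by rewrite ffactSS.
  by apply: leq_mul => //; rewrite ltnS leq_addr.
rewrite -bin_ffact mulnC leq_mul2l; apply/orP; right.
rewrite addnC (_ : 2 ^ _ = \sum_(i < (p + n).+1) 'C(p + n, i)); last first.
  rewrite -[2]/(1 + 1) expnDn; apply: eq_bigr => i _.
  by rewrite !exp1n !muln1.
have pn : p < (p + n).+1 by rewrite ltnS leq_addr.
by rewrite (bigD1 (Ordinal pn)) //= leq_addr.
Qed.

(** * Topological entropy and horseshoes *)

Local Open Scope classical_set_scope.
Local Open Scope ring_scope.

Section LimSup.
Context {R : realType}.
Implicit Types (u v : (\bar R)^nat) (l : \bar R).
Local Open Scope ereal_scope.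

Lemma limn_esupE u : limn_esup u = ereal_inf (range (esups u)).
Proof. by rewrite limn_esup_lim; apply/cvg_lim => //; exact: cvg_esups_inf. Qed.

Lemma limn_esup_le u l N : (forall n, (N <= n)%N -> u n <= l) -> limn_esup u <= l.
Proof.
move=> ul; rewrite limn_esupE.
apply: le_trans (_ : esups u N <= l); first by apply: ereal_inf_lbound; exists N.
by apply: ge_ereal_sup => _ [n /= Nn <-]; exact: ul.
Qed.

Lemma limn_esup_ge u l :
  (forall N, exists2 n, (N <= n)%N & l <= u n) -> l <= limn_esup u.
Proof.
move=> ul; rewrite limn_esupE; apply: le_ereal_inf_tmp => _ [N _ <-].
have [n Nn lun] := ul N; apply: (le_trans lun).
by apply: ereal_sup_ubound; exists n.
Qed.

Lemma le_limn_esup u v : (forall n, u n <= v n) -> limn_esup u <= limn_esup v.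
Proof.
move=> uv; rewrite !limn_esupE; apply: le_ereal_inf_tmp => _ [N _ <-].
apply: le_trans (_ : esups u N <= _); first by apply: ereal_inf_lbound; exists N.
apply: ge_ereal_sup => _ [n /= Nn <-]; apply: le_trans (uv n) _.
by apply: ereal_sup_ubound; exists n.
Qed.

Lemma eqy_ln (h : \bar R) : (forall k, (ln k.+2%:R)%:E <= h) -> h = +oo.
Proof.
move=> hk; apply/eqyP => A A0; apply: le_trans (hk (Num.truncn (expR A))).
rewrite lee_fin -[leLHS]expRK ler_ln ?posrE ?expR_gt0 ?ltr0n //.
by apply: ltW; apply: lt_le_trans (truncnS_gt _) _; rewrite ler_nat.
Qed.

End LimSup.

Section Entropy.
Context {R : realType} {T : metricType R}.
Implicit Types (f : T -> T) (eps : R).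

Lemma le_lne (x y : \bar R) : (x <= y)%E -> (lne x <= lne y)%E.
Proof.
move=> xy; have [x0|x0] := leP x 0%E; first by rewrite le0_lneNy // leNye.
rewrite lee_lne // in_itv /= leey andbT; first exact: ltW.
exact: le_trans (ltW x0) xy.
Qed.

Lemma entropy_at_nonincreasing f : nonincreasing_fun (entropy_at f).
Proof.
move=> eps1 eps2 e12; apply: le_limn_esup => n.
apply: lee_wpmul2l; first by rewrite lee_fin invr_ge0.
apply: le_lne; apply: ereal_sup_le => _ [E /= sE <-]; exists E => //.
by move=> x y xE yE xy; apply: le_lt_trans e12 _; exact: sE.
Qed.

Lemma topological_entropyE f :
  topological_entropy f = ereal_sup (entropy_at f @` [set` `]0, +oo[ ]).
Proof.
apply: cvg_lim => //; apply: nonincreasing_at_right_cvge => //.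
by move=> ? ? _ _; exact: entropy_at_nonincreasing.
Qed.

Lemma entropy_at_le f eps : 0 < eps -> (entropy_at f eps <= topological_entropy f)%E.
Proof.
move=> e0; rewrite topological_entropyE; apply: ereal_sup_ubound.
by exists eps => //=; rewrite in_itv /= andbT.
Qed.

Lemma entropy_gt_scale f (M : \bar R) :
  (M < topological_entropy f)%E -> exists2 eps, 0 < eps & (M < entropy_at f eps)%E.
Proof.
rewrite topological_entropyE => /ereal_sup_gt[_ [eps /= + <-] Me].
by rewrite in_itv /= andbT; exists eps.
Qed.

Lemma separated_le_max f n eps E : Defs.separated f n eps E ->
  ((#|` E|%:R)%:E <= max_separated f n eps)%E.
Proof. by move=> sE; apply: ereal_sup_ubound; exists E. Qed.

Lemma bowen_dist_ge f n i (x y : T) : (i < n)%N ->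
  mdist (iter i f x) (iter i f y) <= bowen_dist f n x y.
Proof.
move=> ltin; rewrite /bowen_dist.
exact: (@le_bigmax _ _ _ 0
  (fun i : 'I_n => mdist (iter i f x) (iter i f y)) (Ordinal ltin)).
Qed.

(** Each sequence of m indices is followed by the f ^ s-orbit of a point of A,
    constructed backwards from the last index; orbits of different sequences
    are eps apart at some time before s m. So there are (s m, eps)-separated sets
    of #|I| ^ m points. *)
Lemma horseshoe_entropy f (I : finType) (s : nat) (A : set T) (K : I -> set T) eps :
  (0 < s)%N -> 0 < eps -> (0 < #|I|)%N -> A !=set0 ->
  (forall i, K i `<=` A) ->
  (forall i y, A y -> exists2 x, K i x & iter s f x = y) ->
  (forall i j x y, i != j -> K i x -> K j y ->
     exists2 t, (t < s)%N & eps < mdist (iter t f x) (iter t f y)) ->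
  ((ln #|I|%:R / s%:R)%:E <= topological_entropy f)%E.
Proof.
move=> s0 e0 I0 [a Aa] KA Kf Ksep.
have [h hP] : exists h : I -> T -> T, forall i y, A y -> K i (h i y) /\ iter s f (h i y) = y.
  have : forall p : I * T, exists x, A p.2 -> K p.1 x /\ iter s f x = p.2.
    move=> [i y]; have [Ay|nAy] := pselect (A y); last by exists y.
    by have [x Kx fx] := Kf i y Ay; exists x.
  by case/choice => h hP; exists (fun i y => h (i, y)) => i y; exact: (hP (i, y)).
pose pt := foldr h a.
have ptA c : A (pt c).
  by elim: c => [//|i c IH] /=; apply: (KA i); apply: (hP _ _ IH).1.
have ptsep m (c d : seq I) : size c = m -> size d = m -> c != d ->
    exists2 u, (u < s * m)%N & eps < mdist (iter u f (pt c)) (iter u f (pt d)).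
  elim: m c d => [|m IH] c d; first by move=> /size0nil -> /size0nil ->; rewrite eqxx.
  case: c => // i c; case: d => // j d [sc] [sd] cd.
  have [Ki fi] := hP i _ (ptA c); have [Kj fj] := hP j _ (ptA d).
  have [ij|ij] := eqVneq i j; last first.
    have [t ts et] := Ksep _ _ _ _ ij Ki Kj; exists t => //.
    by rewrite mulnS; apply: leq_trans ts _; rewrite leq_addr.
  have [|u us eu] := IH c d sc sd; first by apply: contraNN cd => /eqP ->; rewrite ij.
  exists (u + s)%N; first by rewrite mulnS addnC ltn_add2l.
  by rewrite !iterD /= fi fj.
apply: le_trans (entropy_at_le f e0); apply: limn_esup_ge => N.
exists (s * N.+1)%N; first by rewrite (leq_trans (leqnSn N)) // leq_pmull.
pose xs := [seq pt (val c) | c <- enum {: N.+1.-tuple I}].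
pose E := [fset x in xs]%fset.
have sE : Defs.separated f (s * N.+1) eps E.
  move=> x y; rewrite !inE /= => /mapP[c _ ->] /mapP[d _ ->] cd.
  have [|u us eu] := ptsep N.+1 (val c) (val d) (size_tuple _) (size_tuple _).
    by apply: contraNN cd => /eqP ->.
  exact: lt_le_trans eu (bowen_dist_ge _ _ _ us).
have cE : #|` E| = (#|I| ^ N.+1)%N.
  apply: (etrans (card_fseq xs)).
  rewrite undup_id; first by rewrite size_map -cardE card_tuple.
  rewrite (@map_inj_uniq _ _ (fun c : N.+1.-tuple I => pt (val c))) ?enum_uniq //.
  move=> c d /= cd; apply: val_inj; apply/eqP; apply: contraT => ncd.
  have [u _] := ptsep _ _ _ (size_tuple c) (size_tuple d) ncd.
  by rewrite cd mdistxx ltNge (ltW e0).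
have I0' : 0 < #|I|%:R :> R by rewrite ltr0n.
apply: le_trans (_ : ((s * N.+1)%:R^-1)%:E * lne (#|` E|%:R)%:E <= _)%E; last first.
  apply: lee_wpmul2l; first by rewrite lee_fin invr_ge0.
  exact/le_lne/separated_le_max.
rewrite cE natrX lne_EFin ?exprn_gt0 // -EFinM lee_fin lnXn // natrM invfM.
by rewrite -[ln _ *+ _]mulr_natl -mulrA mulKf ?pnatr_eq0 // mulrC.
Qed.

End Entropy.

(** * Continuous functions on the line *)

Section RealLine.
Context {R : realType}.
Implicit Types (F : R -> R) (a b x y : R).

Definition between a b x := Num.min a b <= x <= Num.max a b.

Lemma betweenC a b x : between a b x = between b a x.
Proof. by rewrite /between minC maxC. Qed.

Lemma between_le a b x : a <= b -> between a b x = (a <= x <= b).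
Proof. by move=> ab; rewrite /between (min_idPl ab) (max_idPr ab). Qed.

Lemma IVT_between F a b v : continuous F -> F a <= v <= F b ->
  exists2 c, between a b c & F c = v.
Proof.
move=> cF /andP[av vb]; wlog ab : a b F cF v av vb / a <= b.
  move=> H; have [ab|/ltW ba] := leP a b; first exact: H.
  have [||||c] := H b a (fun x => - F x) _ (- v); rewrite ?lerN2 //.
    by move=> x; apply: cvgN; exact: cF.
  by rewrite betweenC => cab /oppr_inj <-; exists c.
have [||c] := @IVT _ F a b v ab; first exact: continuous_subspaceT.
  by rewrite ge_min le_max av vb orbT.
by rewrite in_itv /= => cab Fc; exists c => //; rewrite between_le.
Qed.

Lemma last_crossing F a b t : continuous F -> a <= b -> F a <= t <= F b ->
  exists u, [/\ a <= u <= b, F u = t & forall x, u < x <= b -> t < F x].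
Proof.
move=> cF ab /andP[Fat tFb]; pose S := [set x | a <= x <= b /\ F x <= t].
have Sa : S a by split; rewrite ?lexx.
have supS : has_sup S by split; [exists a|exists b => x [/andP[]]].
have [u_a u_b] : a <= sup S /\ sup S <= b.
  split; first exact: sup_upper_bound supS _ Sa.
  by apply: ge_sup; [exists a | move=> x [/andP[]]].
have after x : sup S < x <= b -> t < F x.
  move=> /andP[ux xb]; rewrite ltNge; apply/negP => Fx.
  have : x <= sup S.
    by apply: sup_upper_bound supS _ _; split=> //; rewrite xb (le_trans u_a) // ltW.
  by rewrite leNgt ux.
have Fu : F (sup S) <= t.
  rewrite leNgt; apply/negP => tFu.
  have /cvgrPdist_lt/(_ (F (sup S) - t)) := cF (sup S).
  rewrite subr_gt0 => /(_ tFu)/nbhs_ballP[d /= d0 H].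
  have [x Sx ux] := sup_adherent d0 supS.
  have xu := sup_upper_bound supS Sx.
  have := H x; rewrite /ball /= => /(_ _).
  rewrite ger0_norm ?subr_ge0 // ltrBlDr -ltrBlDl => /(_ ux).
  case: Sx => _ Fx; rewrite ltr_norml => /andP[_]; lra.
exists (sup S); split; rewrite ?u_a ?u_b //.
apply/eqP; rewrite eq_le Fu /= leNgt; apply/negP => Fut.
have [|c] := @IVT_between F (sup S) b t cF; first by rewrite (ltW Fut).
rewrite between_le // => /andP[uc cb] Fc.
move: uc; rewrite le_eqVlt => /predU1P[ucE|uc]; first by rewrite -Fc ucE ltxx in Fut.
by have := after c; rewrite uc cb Fc ltxx => /(_ isT).
Qed.

(** A segment can be shrunk so that its image by F does not exceed the segment
    between the values at its ends: for F a <= F b, cut it at the last point of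
    value F a, then at the first later point of value F b. *)
Lemma tight_segment F a b : continuous F ->
  exists u v, [/\ between a b u, between a b v, F u = F a, F v = F b &
    forall x, between u v x -> between (F a) (F b) (F x)].
Proof.
move=> cF; wlog ab : a b / a <= b.
  move=> H; have [ab|/ltW ba] := leP a b; first exact: H.
  have [u [v [hu hv Fu Fv Fuv]]] := H b a ba; exists v, u; split => //.
  - by rewrite betweenC.
  - by rewrite betweenC.
  - by move=> x; rewrite betweenC => /Fuv; rewrite betweenC.
wlog Fab : F cF / F a <= F b.
  move=> H; have [Fab|/ltW Fba] := leP (F a) (F b); first exact: H.
  have [||u [v [hu hv /oppr_inj Fu /oppr_inj Fv Fuv]]] := H (fun x => - F x).
  - by move=> x; apply: cvgN; exact: cF.
  - by rewrite lerN2.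
  exists u, v; split => // x /Fuv.
  by rewrite between_le ?lerN2 // betweenC between_le // andbC.
have [|u [/andP[au ub] Fu Fgt]] := last_crossing (t := F a) cF ab.
  by rewrite lexx.
have cG : continuous (fun x => - F (- x)).
  by move=> x; apply: cvgN; apply: (continuous_comp _ (cF (- x))); exact: opp_continuous.
(* The first crossing of F b is the last crossing of -F b by x |-> -F (-x). *)
have [||w] := @last_crossing (fun x => - F (- x)) (- b) (- u) (- F b) cG.
- by rewrite lerN2.
- by rewrite !opprK lexx lerN2 Fu.
move=> [/andP[bw wu] /oppr_inj Fw Flt].
exists u, (- w); split => //; first by rewrite between_le // au.
  by rewrite between_le //; apply/andP; split; lra.
move=> x; rewrite !between_le //; last by rewrite lerNr.
move=> /andP[ux xw]; apply/andP; split.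
  move: ux; rewrite le_eqVlt => /predU1P[<-|ux]; first by rewrite Fu.
  by apply/ltW/Fgt; rewrite ux (le_trans xw) // lerNl.
move: xw; rewrite le_eqVlt => /predU1P[->|xw]; first by rewrite Fw.
have := Flt (- x); rewrite opprK ltrN2; rewrite lerN2 ux ltrNr xw.
by move=> /(_ isT)/ltW.
Qed.

(** Heine's theorem; only one of the two points needs to lie in the segment. *)
Lemma uniform_continuity F a b (e : R) : continuous F -> 0 < e ->
  exists2 d, 0 < d & forall x y, a <= x <= b -> `|x - y| < d -> `|F x - F y| < e.
Proof.
move=> cF e0; have e20 : 0 < e / 2 by rewrite divr_gt0.
have /compact_near_coveringP/near_covering_withinP := @segment_compact R a b.
move=> /(_ R (0^'+) (fun d x => forall y, `|x - y| < d -> `|F x - F y| < e)).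
case.
  move=> x xab.
  have /cvgrPdist_lt/(_ _ e20)/nbhs_ballP[d /= d0 H] := cF x.
  have d20 : 0 < d / 2 by rewrite divr_gt0.
  near=> x' d' => _ y x'y.
  have xx' : `|x - x'| < d / 2.
    by near: x'; exact: nbhsx_ballx.
  have d'd : d' < d / 2.
    by near: d'; exact: nbhs_right_lt.
  have H1 : `|F x - F x'| < e / 2 by apply: H; rewrite /ball /=; lra.
  have H2 : `|F x - F y| < e / 2.
    apply: H; rewrite /ball /=; apply: le_lt_trans (ler_distD x' _ _) _.
    by rewrite (splitr d) ltrD // (lt_trans x'y).
  apply: le_lt_trans (ler_distD (F x) _ _) _.
  by rewrite (splitr e) ltrD // distrC.
move=> d /= d0 dH; exists (d / 2); first by rewrite divr_gt0.
move=> x y xab; apply: (dH (d / 2)) => //=; rewrite ?divr_gt0 // ?in_itv //=.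
by rewrite sub0r normrN gtr0_norm ?divr_gt0 // ltr_pdivrMr // ltr_pMr // ltr1n.
Unshelve. all: by end_near. Qed.

End RealLine.

(** * Extension of self-maps of the interval to the line *)

Section Extension.
Context {R : realType}.
Notation I := (unit_interval R).
Implicit Types (f g : I -> I) (x y : I).

Lemma set_val01 x : 0 <= (set_val x : R) <= 1.
Proof. by have := valP x; rewrite inE /= in_itv. Qed.

Let clamp_subproof (t : R) : Num.min 1 (Num.max 0 t) \in (`[0, 1]%classic : set R).
Proof.
rewrite inE /= in_itv /= le_min ler01 ge_min lexx /= andbT.
by rewrite le_max lexx.
Qed.

Definition clamp (t : R) : I :=
  exist (fun s : R => s \in (`[0, 1]%classic : set R)) _ (clamp_subproof t).

Lemma clampK x : clamp (set_val x) = x.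
Proof.
have /andP[x0 x1] := set_val01 x.
by apply: val_inj => /=; rewrite (max_idPr x0) (min_idPr x1).
Qed.

Lemma set_val_clamp (t : R) : 0 <= t <= 1 -> set_val (clamp t) = t.
Proof. by move=> /andP[t0 t1]; rewrite set_valE /= (max_idPr t0) (min_idPr t1). Qed.

Lemma mdist_unit x y : mdist x y = `|set_val x - set_val y| :> R.
Proof. by []. Qed.

Lemma set_val_continuous : continuous (set_val : I -> R).
Proof. exact: initial_continuous. Qed.

Lemma clamp_continuous : continuous clamp.
Proof.
move=> t; apply/cvg_ballP => e e0; near=> s.
rewrite ballEmdist /= mdist_unit /=.
have : `|t - s| < e by near: s; exact: (nbhsx_ballx t e).
rewrite !set_valE /= !ltr_norml /Num.min /Num.max.
case: (@ltP _ R 0 t) => t0; case: (@ltP _ R 0 s) => s0.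
all: rewrite ?ltr10; try case: (@ltP _ R 1 t) => t1; try case: (@ltP _ R 1 s) => s1.
all: by lra.
Unshelve. all: by end_near. Qed.

(** Self-maps of [0, 1] are extended to the line by constants, so that the
    theorems on real functions apply without side conditions on the domain. *)
Definition extend f (t : R) : R := set_val (f (clamp t)).

Lemma extend_continuous f : continuous f -> continuous (extend f).
Proof.
move=> cf t; apply: (@continuous_comp _ _ _ clamp (set_val \o f)).
  exact: clamp_continuous.
by apply: continuous_comp; [exact: cf|exact: set_val_continuous].
Qed.

Lemma extend_iter f n x : iter n (extend f) (set_val x) = set_val (iter n f x).
Proof. by elim: n => //= n ->; rewrite /extend clampK. Qed.

Lemma iter_clamp f n (t : R) : 0 <= t <= 1 ->
  set_val (iter n f (clamp t)) = iter n (extend f) t.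
Proof. by move=> t01; rewrite -extend_iter set_val_clamp. Qed.

Lemma extend01 f t : 0 <= extend f t <= 1.
Proof. exact: set_val01. Qed.

Lemma unit_continuousP (f : I -> I) (x : I) :
  {for x, continuous f} <-> forall b : R, 0 < b -> exists2 d : R, 0 < d &
    forall y, `|set_val x - set_val y| < d -> `|set_val (f x) - set_val (f y)| < b.
Proof.
split.
  move=> cf b b0; have /cvg_ballP/(_ b b0)/nbhs_ballP[d d0 H] := cf.
  by exists d.
move=> H; apply/(@cvg_ballP R I _ (nbhs x) (nbhs_filter x)) => b b0.
have [d d0 fd] := H b b0.
by apply/nbhs_ballP; exists d.
Qed.

End Extension.

(** * The covering graph of an interval map *)

Section CoveringGraph.
Context {R : realType} (F : R -> R) (N : nat).
Hypotheses (cF : continuous F) (N0 : (0 < N)%N).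

Definition piece (j : nat) : set R :=
  [set t | j%:R / N%:R <= t <= (j%:R + 1) / N%:R].

Definition interval_set := {L : set R | is_interval L}.

Lemma is_interval_piece j : is_interval (piece j).
Proof.
move=> x y /= /andP[jx _] /andP[_ yj] z /andP[xz zy].
by apply/andP; split; [exact: le_trans jx xz|exact: le_trans zy yj].
Qed.

Definition piece_interval (j : 'I_N) : interval_set :=
  exist _ _ (@is_interval_piece j).

Lemma is_interval_image L : is_interval L -> is_interval (F @` L).
Proof.
move=> iL _ _ [a La <-] [b Lb <-] z azb.
have [c cab <-] := IVT_between cF azb; exists c => //.
have [ab|/ltW ba] := leP a b; first by apply: (iL a b); rewrite -?between_le.
by apply: (iL b a); rewrite -?between_le // betweenC.
Qed.

Definition next_set (L : set R) (j : nat) := F @` L `&` piece j.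

Lemma is_interval_next L j : is_interval L -> is_interval (next_set L j).
Proof.
move=> iL x y [Fx px] [Fy py] z xzy.
by split; [exact: is_interval_image Fx Fy z xzy | exact: is_interval_piece px py z xzy].
Qed.

Definition cover_next (L : interval_set) (j : 'I_N) : interval_set :=
  exist _ _ (@is_interval_next _ j (svalP L)).

Definition reaches (L : interval_set) : pred 'I_N :=
  fun j => `[< next_set (sval L) j !=set0 >].

(** F(L) covers the piece j and, on each side, a margin of the length of a piece.
    The margin makes the covering stable under perturbation; because of
    it, self-maps of [0, 1] never cross the two extreme pieces. *)
Definition crosses (L : interval_set) : pred 'I_N := fun j =>
  `[< exists p q, [/\ sval L p, sval L q, F p <= (j%:R - 1) / N%:R &
                      (j%:R + 2) / N%:R <= F q] >].

Lemma pdivN_le (a b : R) : a <= b -> a / N%:R <= b / N%:R.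
Proof. by move=> ab; rewrite ler_pM2r // invr_gt0 ltr0n. Qed.

Lemma crosses_cover L j : crosses L j -> piece j `<=` F @` sval L.
Proof.
move/asboolP => [p [q [Lp Lq Fp Fq]]] t /= /andP[jt tj].
apply: (is_interval_image (svalP L)); [by exists p|by exists q|].
apply/andP; split.
  by apply: le_trans Fp _; apply: le_trans jt; apply: pdivN_le; lra.
by apply: le_trans Fq; apply: le_trans tj _; apply: pdivN_le; lra.
Qed.

Lemma piece_left j : piece j (j%:R / N%:R).
Proof. by rewrite /piece /= lexx pdivN_le //; lra. Qed.

Lemma crosses_reaches L j : crosses L j -> reaches L j.
Proof.
move=> /crosses_cover Lj; apply/asboolP; exists (j%:R / N%:R).
by split; [apply: Lj|]; exact: piece_left.
Qed.

Lemma crosses_next L j : crosses L j -> cover_next L j = piece_interval j.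
Proof.
move=> /crosses_cover Lj; apply: eq_exist.
by rewrite /next_set setIC; apply/setIidPl.
Qed.

Lemma card_consecutive (X : pred 'I_N) :
  (forall i j : 'I_N, X i -> X j -> (i < j)%N -> (j < i.+2)%N) -> (#|X| <= 2)%N.
Proof.
move=> H; have [i0 Xi0|X0] := pickP X; last by rewrite eq_card0.
case: (@arg_minnP _ i0 X val Xi0) => i Xi imin.
rewrite cardE -(size_map val); apply: (@uniq_leq_size _ _ [:: val i; (val i).+1]).
  by rewrite map_inj_uniq ?enum_uniq //; exact: val_inj.
move=> _ /mapP[j + ->]; rewrite mem_enum => Xj; rewrite !inE.
have := imin j Xj; rewrite leq_eqVlt => /predU1P[/= ->|ij]; first by rewrite eqxx.
by have := H i j Xi Xj ij; rewrite ltnS => ?; apply/orP; right; rewrite eqn_leq ij andbT.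
Qed.

(** The pieces met by the interval F(L) are consecutive, and only the first two and
    the last two can lack one of the two margins. *)
Lemma partial_card L : (#|[pred j | reaches L j && ~~ crosses L j]| <= 4)%N.
Proof.
pose X1 : pred 'I_N := fun j =>
  reaches L j && `[< forall p, sval L p -> (j%:R - 1) / N%:R < F p >].
pose X2 : pred 'I_N := fun j =>
  reaches L j && `[< forall q, sval L q -> F q < (j%:R + 2) / N%:R >].
have N0R : 0 < N%:R^-1 :> R by rewrite invr_gt0 ltr0n.
have X1c : (#|X1| <= 2)%N.
  apply: card_consecutive => i j /andP[/asboolP[_ [[p Lp <-] /andP[_ pi]]] _].
  move=> /andP[_ /asboolP/(_ p Lp) jp] _.
  have := lt_le_trans jp pi; rewrite ltr_pM2r // => ji.
  by rewrite -(ltr_nat R) -addn2 natrD; lra.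
have X2c : (#|X2| <= 2)%N.
  apply: card_consecutive => i j /andP[_ /asboolP iF].
  move=> /andP[/asboolP[_ [[q Lq <-] /andP[jq _]]] _] _.
  have := le_lt_trans jq (iF q Lq); rewrite ltr_pM2r // => ji.
  by rewrite -(ltr_nat R) -addn2 natrD; lra.
apply: leq_trans (leq_add X1c X2c); rewrite -cardUI.
apply: leq_trans (leq_addr _ _); apply: subset_leq_card; apply/fintype.subsetP => j.
rewrite !inE => /andP[rj /asboolPn ncj]; rewrite !unfold_in /X1 /X2 rj /=.
have [p1|/asboolPn] := boolP `[< forall p, sval L p -> (j%:R - 1) / N%:R < F p >] => //.
move=> /existsNP[p /not_implyP[Lp /negP]]; rewrite -leNgt => Fp.
apply/asboolP => q Lq; rewrite ltNge; apply/negP => Fq; apply: ncj.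
by exists p, q.
Qed.

(** An orbit stays in the followed intervals, so its itinerary is a word. *)
Lemma mem_itinerary (L : interval_set) t (w : seq 'I_N) : sval L t ->
  (forall i, (i < size w)%N -> piece (nth 0%N (map val w) i) (iter i.+1 F t)) ->
  w \in words cover_next (allow reaches crosses [set: 'I_N]%SET) (size w) L.
Proof.
elim: w L t => [//|j w IH] L t Lt wt /=.
have jF : next_set (sval L) j (F t) by split; [exists t|exact: (wt 0%N)].
apply/flatten_mapP; exists j.
  rewrite mem_filter mem_enum andbT /allow inE implybT andbT.
  by apply/asboolP; exists (F t).
apply: map_f; apply: (IH _ (F t)) => // i iw.
by have := wt i.+1 iw; rewrite /= -iterS iterSr.
Qed.

(** Along a word, any two points of the last interval are the ends of the image of
    a segment all of whose points have the given itinerary. A segment, rather than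
    its end points only, is needed to apply the intermediate value theorem to
    nearby maps. *)
Lemma pull_back (L : interval_set) (w : seq 'I_N) p q :
  sval (foldl cover_next L w) p -> sval (foldl cover_next L w) q ->
  exists u v, [/\ sval L u, sval L v, iter (size w) F u = p, iter (size w) F v = q &
    forall x, between u v x -> between p q (iter (size w) F x) /\
      forall i, (i < size w)%N -> piece (nth 0%N (map val w) i) (iter i.+1 F x)].
Proof.
elim: w L => [|j w IH] L /=; first by move=> Lp Lq; exists p, q; split.
move=> /IH{}IH /IH[a' [b' [[[a La Fa] pa] [[b Lb Fb] pb] Fp Fq ab]]].
have [u [v [uab vab Fu Fv Fuv]]] := tight_segment a b cF.
have Lab x : between a b x -> sval L x.
  move=> abx; have [ab'|/ltW ba'] := leP a b.
    by apply: (svalP L a b) => //; rewrite -between_le.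
  by apply: (svalP L b a) => //; rewrite -between_le // betweenC.
have shift x : F (iter (size w) F x) = iter (size w) F (F x) by rewrite -iterS iterSr.
exists u, v; split; [exact: Lab|exact: Lab|by rewrite shift Fu Fa|by rewrite shift Fv Fb|].
move=> x /Fuv; rewrite Fa Fb => Fx; rewrite shift; have [Fpq Fi] := ab _ Fx.
split=> // -[_|i iw] /=; last by rewrite -iterS iterSr; exact: Fi.
have [ab'|/ltW ba'] := leP a' b'.
  by apply: (is_interval_piece pa pb); rewrite -between_le.
by apply: (is_interval_piece pb pa); rewrite -between_le // betweenC.
Qed.

End CoveringGraph.

(** * Few returns force small entropy *)

Section UpperBound.
Context {R : realType}.
Notation I := (unit_interval R).
Variable f : I -> I.
Hypothesis cf : continuous f.
Let F := extend f.
Let cF : continuous F := extend_continuous cf.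

Lemma cell_exists N (t : R) : (0 < N)%N -> 0 <= t <= 1 ->
  exists j : 'I_N, piece N j t.
Proof.
move=> N0 /andP[t0 t1]; have NR : 0 < N%:R :> R by rewrite ltr0n.
have /truncn_itv/andP[kt tk] : 0 <= t * N%:R by rewrite mulr_ge0.
set k := Num.truncn _ in kt tk.
have [kN|Nk] := ltnP k N.
  exists (Ordinal kN); apply/andP; split.
    by rewrite ler_pdivrMr.
  by rewrite ler_pdivlMr // natr1 ltW.
have t_1 : t = 1.
  apply/eqP; rewrite eq_le t1 -(ler_pM2r NR) mul1r.
  by rewrite (le_trans _ kt) // ler_nat.
have NN : (N.-1 < N)%N by rewrite prednK.
exists (Ordinal NN); apply/andP; split => /=.
  by rewrite ler_pdivrMr // t_1 mul1r ler_nat leq_pred.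
by rewrite natr1 prednK // divff ?t_1 // gt_eqF.
Qed.

Lemma piece_diam N j (s t : R) : (0 < N)%N -> piece N j s -> piece N j t ->
  `|s - t| <= N%:R^-1.
Proof.
move=> N0 /andP[s1 s2] /andP[t1 t2].
rewrite mulrDl mul1r in s2 t2.
by rewrite ler_norml; apply/andP; split; lra.
Qed.

Definition itineraries N m (L : interval_set) :=
  words (@cover_next R F N cF) (allow (@reaches R F N) (@crosses R F N) [set: 'I_N]%SET) m L.

(** Points with the same itinerary stay within 1 / N of each other, so a separated
    set has at most as many points as there are itineraries. *)
Lemma separated_card N eps m (E : {fset I}) : (0 < N)%N -> N%:R^-1 <= eps ->
  Defs.separated f m.+1 eps E ->
  (#|` E| <= \sum_(j < N) size (itineraries N m (piece_interval j)))%N.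
Proof.
move=> N0 Neps sE.
have /choice[cell cellP] : forall x : I, exists j : 'I_N, piece N j (set_val x : R).
  by move=> x; exact: cell_exists N0 (set_val01 x).
pose itin x := (cell x, [seq cell (iter i.+1 f x) | i <- iota 0 m]).
pose all_itin := flatten
  [seq [seq (j, w) | w <- itineraries N m (piece_interval j)]
     | j <- index_enum (ordinal N : finType)].
have <- : size all_itin = (\sum_(j < N) size (itineraries N m (piece_interval j)))%N.
  rewrite size_flatten sumnE /shape !big_map.
  by apply: eq_bigr => j _; rewrite size_map.
rewrite -(size_map itin); apply: uniq_leq_size.
  rewrite map_inj_in_uniq ?fset_uniq // => x y xE yE [cxy mxy].
  apply/eqP; apply: contraT => /(sE x y xE yE).
  rewrite ltNge => /negP; case; apply: le_trans Neps.
  apply/bigmax_leP; split; first by rewrite invr_ge0.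
  move=> [i /= im] _; rewrite mdist_unit.
  apply: (@piece_diam N (cell (iter i f x))) => //.
  suff -> : cell (iter i f x) = cell (iter i f y) by [].
  case: i im => [//|i]; rewrite ltnS => im.
  have := congr1 (fun s => nth (cell x) s i) mxy.
  by rewrite !(nth_map 0%N) ?size_iota // nth_iota.
move=> _ /mapP[x _ ->]; apply/flatten_mapP; exists (cell x); first exact: mem_index_enum.
apply: map_f; rewrite /itineraries.
rewrite -[X in words _ _ X _](_ : size (itin x).2 = m); last by rewrite size_map size_iota.
apply: (@mem_itinerary _ _ _ cF _ (set_val x)); first exact: cellP.
move=> i; rewrite size_map size_iota => im.
rewrite extend_iter (nth_map (cell x)) ?size_map ?size_iota //.
by rewrite (nth_map 0%N) ?size_iota // nth_iota //; exact: cellP.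
Qed.

(** In (4 B) ^ n, a factor 2 ^ n absorbs the polynomial of [words_bound], another
    one the constants. *)
Lemma few_returns_entropy_le B N eps : (3 < B)%N -> (0 < N)%N -> N%:R^-1 <= eps ->
  (forall l n, (arrivals (@cover_next R F N cF) (@reaches R F N) (@crosses R F N)
                  l n (piece_interval l) <= B ^ n.+1)%N) ->
  (entropy_at f eps <= (ln (4 * B)%:R)%:E)%E.
Proof.
move=> B4 N0 Neps few.
have B0 : (0 < B)%N by apply: leq_trans B4.
have [p Wp] := words_bound (@crosses_reaches _ F N cF N0) (@crosses_next _ F N cF N0)
  (@partial_card _ F N N0) B0 B4 few [set: 'I_N]%SET.
have [K pK] := poly_leq_exp p.
apply: (@limn_esup_le _ _ _ (N * K).+1) => -[//|m] NKm.
have m0 : 0 < m.+1%:R :> R by rewrite ltr0n.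
rewrite lee_pdivrMl //.
have max_le : (max_separated f m.+1 eps <= ((4 * B) ^ m.+1)%:R%:E)%E.
  apply: ge_ereal_sup => _ [E /= sE <-]; rewrite lee_fin ler_nat.
  apply: leq_trans (separated_card N0 Neps sE) _.
  apply: leq_trans (_ : \sum_(j < N) (K * 2 ^ m * B ^ m) <= _)%N.
    apply: leq_sum => j _; apply: leq_trans (Wp _ _) _.
    by rewrite leq_mul2r pK orbT.
  rewrite sum_nat_const card_ord (_ : 4 * B = 2 * (2 * B))%N; last by lia.
  rewrite (_ : N * _ = (N * K) * (2 * B) ^ m)%N; last by rewrite expnMn; lia.
  rewrite (expnMn 2 (2 * B)); apply: leq_mul.
    by apply: ltnW; apply: leq_trans NKm (ltnW (ltn_expl _ _)).
  by rewrite leq_pexp2l // muln_gt0.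
apply: le_trans (le_lne max_le) _.
have B40 : 0 < (4 * B)%:R :> R by rewrite ltr0n muln_gt0.
rewrite natrX lne_EFin ?exprn_gt0 // lnXn // -EFinM lee_fin.
by rewrite mulr_natl.
Qed.

End UpperBound.

(** * Large entropy persists under perturbation *)

Section Robust.
Context {R : realType}.
Notation I := (unit_interval R).

Lemma iter_continuous (F : R -> R) n : continuous F -> continuous (iter n F).
Proof.
move=> cF; elim: n => [|n IH] x; first exact: cvg_id.
exact: (@continuous_comp _ _ _ (iter n F) F x (IH x) (cF _)).
Qed.

Lemma iter_close (f : I -> I) s (eta : R) : continuous f -> 0 < eta ->
  exists2 d, 0 < d & forall g : I -> I,
    (forall x, `|set_val (f x) - set_val (g x)| < d) ->
    forall t x, (t <= s)%N -> `|set_val (iter t f x) - set_val (iter t g x)| < eta.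
Proof.
move=> cf; elim: s eta => [|s IH] eta eta0.
  exists 1 => // g _ t x; rewrite leqn0 => /eqP -> /=.
  by rewrite subrr normr0.
have eta2 : 0 < eta / 2 by rewrite divr_gt0.
have [d d0 fd] := uniform_continuity 0 1 (extend_continuous cf) eta2.
have [|d' d'0 H] := IH (Num.min d eta); first by rewrite lt_min d0.
exists (Num.min d' (eta / 2)); first by rewrite lt_min d'0.
move=> g fg t x.
have {}H : forall t x, (t <= s)%N ->
    `|set_val (iter t f x) - set_val (iter t g x)| < Num.min d eta.
  by apply: H => y; apply: lt_le_trans (fg y) _; rewrite ge_min lexx.
rewrite leq_eqVlt => /predU1P[->|ts].
  have fgs : `|set_val (iter s f x) - set_val (iter s g x)| < d.
    by have := H s x (leqnn s); rewrite lt_min => /andP[].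
  have := fd _ _ (set_val01 (iter s f x)) fgs.
  rewrite /extend !clampK => ffs /=.
  apply: le_lt_trans (ler_distD (set_val (f (iter s g x))) _ _) _.
  rewrite (splitr eta) ltrD //; apply: lt_le_trans (fg _) _.
  by rewrite ge_min lexx orbT.
by have := H t x ts; rewrite lt_min => /andP[].
Qed.

Lemma piece01 N l (t : R) : (l < N)%N -> piece N l t -> 0 <= t <= 1.
Proof.
move=> lN /andP[lt tl]; have N0 : 0 < N%:R :> R by rewrite ltr0n; case: N lN {lt tl}.
rewrite (le_trans _ lt) ?divr_ge0 //=; apply: (le_trans tl).
by rewrite ler_pdivrMr // mul1r natr1 ler_nat.
Qed.

Lemma same_parity_separated N i j (s t : R) : (0 < N)%N -> odd i = odd j -> i != j ->
  piece N i s -> piece N j t -> N%:R^-1 <= `|s - t|.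
Proof.
move=> N0 oij; wlog ij : i j s t oij / (i < j)%N.
  move=> H nij pi pj; case: (ltngtP i j) => [ij|ji|ij]; first exact: (H i j).
    by rewrite distrC; apply: (H j i) => //; rewrite eq_sym.
  by rewrite ij eqxx in nij.
move=> _ /andP[_ si] /andP[jt _].
have ij2 : (i.+2 <= j)%N.
  by rewrite ltn_neqAle ij andbT; apply/eqP => ij1; move: oij; rewrite -ij1 /=; case: odd.
have : (i%:R + 2) / N%:R <= (j%:R : R) / N%:R.
  by rewrite ler_pM2r ?invr_gt0 ?ltr0n // -natrD ler_nat addn2.
have -> : (i%:R + 2) / N%:R = (i%:R + 1) / N%:R + N%:R^-1 :> R by ring.
by rewrite distrC => H; apply: le_trans (ler_norm _); lra.
Qed.

(** A map of infinite entropy has more than (2 C) ^ (n + 1) words of length n + 1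
    returning to some piece l. Those of a common parity pattern provide a horseshoe
    for the (n + 1)-st iterate of every map whose first n + 1 iterates are within
    eta = 1 / (4 N) of those of f: by the margins of length 1 / N the covering
    persists, and points that f puts 1 / N apart are still more than 1 / (2 N)
    apart. *)
Lemma robust_entropy (f : I -> I) C : continuous f -> (1 < C)%N ->
  topological_entropy f = +oo%E ->
  exists2 d, 0 < d & forall g : I -> I, continuous g ->
    (forall x, `|set_val (f x) - set_val (g x)| < d) ->
    ((ln C%:R)%:E <= topological_entropy g)%E.
Proof.
move=> cf C1 hf; set F := extend f; pose cF : continuous F := extend_continuous cf.
have C0 : (0 < C)%N by apply: ltnW.
have [eps eps0 heps] : exists2 eps, 0 < eps &
    ((ln (4 * (2 * C))%:R)%:E < entropy_at f eps)%E.
  by apply: entropy_gt_scale; rewrite hf ltry.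
have [N N0 Neps] : exists2 N, (0 < N)%N & N%:R^-1 <= eps.
  exists (Num.truncn eps^-1).+1 => //.
  by rewrite invf_ple ?posrE ?ltr0n // ltW // truncnS_gt.
have NR : 0 < N%:R^-1 :> R by rewrite invr_gt0 ltr0n.
have [l [n many]] : exists l n, ((2 * C) ^ n.+1 <
    arrivals (@cover_next R F N cF) (@reaches R F N) (@crosses R F N)
      l n (piece_interval l))%N.
  apply: contrapT => few; move: heps; rewrite ltNge => /negP; apply.
  apply: (@few_returns_entropy_le _ _ cf _ N) => //; first by lia.
  by move=> l n; rewrite leqNgt; apply/negP => many; apply: few; exists l, n.
pose ws := [seq w <- words (@cover_next R F N cF) (@reaches R F N) n (piece_interval l) |
   crosses F (foldl (@cover_next R F N cF) (piece_interval l) w) l].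
have wsn w : w \in ws -> size w = n.
  by rewrite mem_filter => /andP[_ H]; apply: mem_words H.
have [|p pc] := @parity_class N n (C ^ n.+1) ws wsn.
  rewrite size_filter; apply: leq_ltn_trans many.
  by rewrite expnMn mulnC leq_mul2r leq_pexp2l ?orbT.
pose zs := [seq w <- ws | [seq odd (val j) | j <- w] == p].
have uzs : uniq zs by rewrite !filter_uniq // uniq_words.
pose J : finType := seq_sub zs.
have szs (w : J) : size (ssval w) = n.
  by have := ssvalP w; rewrite mem_filter => /andP[_ /wsn].
have parity (w w' : J) i : (i < n)%N ->
   odd (nth 0%N (map val (ssval w)) i) = odd (nth 0%N (map val (ssval w')) i).
  move=> ilt; have := ssvalP w; have := ssvalP w'; rewrite !mem_filter.
  move=> /andP[/eqP pw' _] /andP[/eqP pw _].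
  have := congr1 (fun s => nth false s i) (etrans pw (esym pw')).
  by rewrite !(nth_map l) ?szs.
have /choice[uv uvP] : forall w : J, exists uv : R * R,
    [/\ piece N l uv.1, piece N l uv.2,
        iter n.+1 F uv.1 <= (l%:R - 1) / N%:R, (l%:R + 2) / N%:R <= iter n.+1 F uv.2 &
        forall x, between uv.1 uv.2 x -> forall i, (i < n)%N ->
          piece N (nth 0%N (map val (ssval w)) i) (iter i.+1 F x)].
  move=> w; have := ssvalP w; rewrite !mem_filter => /andP[_ /andP[+ _]].
  move=> /asboolP[x [y [Lx Ly Fx Fy]]].
  have [u [v [Lu Lv Fu Fv Fuv]]] := pull_back Lx Ly.
  exists (u, v); rewrite /= -!(szs w) Fu Fv; split => // z /Fuv[_ +] i ilt.
  exact.
pose eta : R := N%:R^-1 / 4.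
have eta0 : 0 < eta by rewrite divr_gt0.
have [d d0 close] := iter_close n.+1 cf eta0.
exists d => // g cg fg; have {}close := close g fg; set G := extend g.
have cG := extend_continuous cg.
have closeR t (x : R) : (t <= n.+1)%N -> 0 <= x <= 1 ->
    `|iter t F x - iter t G x| < eta.
  by move=> tn x01; rewrite -!iter_clamp //; exact: close.
pose A : set I := [set x | piece N l (set_val x)].
pose K (w : J) : set I := [set x | A x /\ between (uv w).1 (uv w).2 (set_val x)].
have iN := is_interval_piece.
have J0 : (C ^ n.+1 < #|J|)%N by rewrite card_seq_sub // size_filter.
have lN : 0 <= (l%:R / N%:R : R) <= 1 by apply: (piece01 (ltn_ord l)); exact: piece_left.
apply: le_trans (_ : ((ln #|J|%:R / n.+1%:R)%:E <= _)%E); last first.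
  apply: (@horseshoe_entropy _ _ g J n.+1 A K (N%:R^-1 / 2)) => //.
  - by rewrite divr_gt0.
  - exact: leq_ltn_trans J0.
  - exists (clamp (l%:R / N%:R)); rewrite /A /= set_val_clamp //.
    exact: piece_left.
  - by move=> w x [].
  - move=> w y /andP[ly yl]; have [pu pv Fu Fv _] := uvP w.
    have Gu := closeR n.+1 _ (leqnn _) (piece01 (ltn_ord l) pu).
    have Gv := closeR n.+1 _ (leqnn _) (piece01 (ltn_ord l) pv).
    have [|c cuv Gc] := @IVT_between _ (iter n.+1 G) (uv w).1 (uv w).2 (set_val y)
        (iter_continuous (n := n.+1) cG).
      rewrite !mulrDl !mulNr ?mul1r in ly yl Fu Fv.
      move: Gu Gv; rewrite !ltr_norml /eta => /andP[? ?] /andP[? ?].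
      by apply/andP; split; lra.
    have pc' : piece N l c.
      have [uv'|/ltW vu] := leP (uv w).1 (uv w).2.
        by apply: (iN _ _ _ _ _ pu pv); rewrite -between_le.
      by apply: (iN _ _ _ _ _ pv pu); rewrite -between_le // betweenC.
    have c01 := piece01 (ltn_ord l) pc'.
    exists (clamp c); first by split; rewrite /A /= set_val_clamp.
    by apply: val_inj; apply: etrans (iter_clamp g n.+1 c01) Gc.
  - move=> w w' x y ww' [_ Kx] [_ Ky].
    have [i ilt wi] : exists2 i, (i < n)%N &
       nth 0%N (map val (ssval w)) i != nth 0%N (map val (ssval w')) i.
      apply: contrapT => same; move/negP: ww'; apply; rewrite -val_eqE /=.
      apply/eqP/(inj_map val_inj)/(@eq_from_nth _ 0%N).
        by rewrite !size_map !szs.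
      move=> i; rewrite size_map szs => ilt; apply/eqP/negPn/negP => wi.
      by apply: same; exists i.
    exists i.+1; first by rewrite ltnS.
    have [_ _ _ _ /(_ _ Kx i ilt) px] := uvP w.
    have [_ _ _ _ /(_ _ Ky i ilt) py] := uvP w'.
    have := same_parity_separated N0 (parity w w' i ilt) wi px py.
    have gx := closeR i.+1 _ (ltnW (ltn_ord (Ordinal ilt))) (set_val01 x).
    have gy := closeR i.+1 _ (ltnW (ltn_ord (Ordinal ilt))) (set_val01 y).
    move: gx gy; rewrite !extend_iter mdist_unit !ltr_norml /eta => /andP[? ?] /andP[? ?].
    rewrite ler_normr => /orP[?|?]; rewrite ltr_normr; apply/orP; [left|right]; lra.
rewrite lee_fin ler_pdivlMr ?ltr0n // mulr_natr -lnXn ?ltr0n // -natrX.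
by rewrite ler_ln ?posrE ?ltr0n ?expn_gt0 ?C0 // ?ler_nat ?(leq_ltn_trans _ J0) // ltnW.
Qed.

End Robust.

(** * Preservation of Lebesgue measure *)

Section Preservation.
Context {R : realType}.
Notation I := (unit_interval R).
Notation mu := (@lebesgue_measure R).
Implicit Types (f : I -> I) (A : set I).

Lemma set_val_image A : set_val @` A = clamp @^-1` A `&` `[0, 1].
Proof.
apply/seteqP; split => [_ [x Ax <-]|t /= [At]].
  by split; rewrite /= ?clampK //= in_itv /= set_val01.
by rewrite in_itv /= => t01; exists (clamp t) => //; exact: set_val_clamp.
Qed.

Lemma lambda01E A : lambda01 A = mu (clamp @^-1` A `&` `[0, 1]).
Proof. by rewrite /lambda01 set_val_image. Qed.

Lemma lambda01_preimage f A :
  lambda01 (f @^-1` A) = mu (extend f @^-1` (clamp @^-1` A) `&` `[0, 1]).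
Proof.
rewrite lambda01E; congr (mu (_ `&` _)).
by apply/funext => t /=; rewrite /extend clampK.
Qed.

Lemma measurable_clamp A : borel01 A -> measurable (clamp @^-1` A : set R).
Proof.
have : sigma_algebra setT [set B : set I | measurable (clamp @^-1` B : set R)].
  split => /= [|B mB|B mB].
  - by rewrite preimage_set0.
  - by rewrite setTD preimage_setC; exact: measurableC.
  - by rewrite preimage_bigcup; exact: bigcupT_measurable.
move=> sigma; apply: (smallest_sub sigma) => B oB /=.
by apply: open_measurable; move/continuousP: (@clamp_continuous R); exact.
Qed.

Lemma borel01_preimage f A : continuous f -> borel01 A -> borel01 (f @^-1` A).
Proof.
move=> cf; have [s0 sC sU] : sigma_algebra setT (borel01 : set (set I)).
  exact: smallest_sigma_algebra.
have : sigma_algebra setT [set B : set I | borel01 (f @^-1` B)].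
  split => /= [|B mB|B mB].
  - by rewrite preimage_set0; exact: s0.
  - by rewrite setTD preimage_setC -setTD; exact: sC.
  - by rewrite preimage_bigcup; exact: sU.
move=> sigma; apply: (smallest_sub sigma) => B oB /=.
by apply: sub_sigma_algebra; move/continuousP: cf; exact.
Qed.

(** The rays ]-oo, t[ generate the Borel sets and are stable under intersection, so
    two finite measures that agree on them are equal. *)
Lemma preserving_of_rays f : continuous f ->
  (forall t, 0 <= t <= 1 -> mu ([set x | extend f x < t] `&` `[0, 1]) = t%:E) ->
  forall A, borel01 A -> lambda01 A = lambda01 (f @^-1` A).
Proof.
move=> cf rays A /measurable_clamp mA.
rewrite lambda01_preimage lambda01E.
have mI : measurable (`[0, 1]%classic : set (measurableTypeR R)) by exact: measurable_itv.
have mF : measurable_fun setT (extend f : measurableTypeR R -> measurableTypeR R).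
  exact: continuous_measurable_fun (extend_continuous cf).
pose F : measurableTypeR R -> measurableTypeR R := extend f.
pose m1 : {measure set (measurableTypeR R) -> \bar R} := mrestr (@lebesgue_measure R) mI.
change (m1 (clamp @^-1` A) = pushforward m1 F (clamp @^-1` A)).
apply: (@measure_unique _ R (measurableTypeR R) (@RGenInftyO.G R)
  (fun n => `]-oo, n%:R[%classic)) => //.
- exact: RGenInftyO.measurableE.
- move=> _ _ [x ->] [y ->]; exists (Num.min x y).
  by apply/seteqP; split => z /=; rewrite !in_itv /= lt_min; [move=> [-> ->]|move/andP].
- by move=> n; exists n%:R.
- apply/seteqP; split => // x _; exists (Num.truncn `|x|).+1 => //=.
  by rewrite in_itv /= (le_lt_trans (ler_norm x)) // truncnS_gt.
- move=> _ [t ->].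
  transitivity (mu ([set x | extend f x < t] `&` `[0, 1])); last first.
    congr (mu (_ `&` _)).
  change (mu (`]-oo, t[ `&` `[0, 1]) = mu ([set x | extend f x < t] `&` `[0, 1])).
  have [t0|t0] := leP t 0.
    congr (mu _); apply/seteqP; split => x /= [].
      by rewrite !in_itv /= => xt /andP[x0 _]; move: (le_lt_trans x0 xt); lra.
    by move=> xt; have /andP[x0 _] := extend01 f x; move: (le_lt_trans x0 xt); lra.
  have [t1|t1] := leP t 1.
    rewrite rays ?t1 ?ltW //.
    have -> : `]-oo, t[ `&` `[0, 1] = `[0, t[%classic :> set R.
      apply/seteqP; split => x /=; rewrite !in_itv /=; first by move=> [-> /andP[->]].
      by move=> /andP[-> xt]; rewrite xt (ltW (lt_le_trans xt t1)).
    by rewrite lebesgue_measure_itv /= lte_fin t0 sube0.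
  congr (mu _); apply/seteqP; split => x /=; rewrite !in_itv /= => -[_ x01]; split=> //.
    by have /andP[_ ] := extend01 f x; move/le_lt_trans; apply.
  by case/andP: x01 => _ /le_lt_trans; apply.
- move=> n; change (mu (`]-oo, (n%:R)%R[ `&` `[0%R, 1%R]) < +oo)%E.
  apply: (@le_lt_trans _ _ (mu `[0%R, 1%R])).
    by apply: le_measure; rewrite ?inE //; apply: measurableI.
  by rewrite lebesgue_measure_itv /= lte01 sube0 ltry.
Qed.

End Preservation.

(** * A measure-preserving fold *)

Section Fold.
Context {R : realType}.
Notation mu := (@lebesgue_measure R).
Variables (c d : R).

(** The identity off the window [c - d, c + d], and on it the zigzag through
    (c - d, c - d), (c - d / 3, c + d), (c + d / 3, c - d), (c + d, c + d),
    written with the lines that carry its three laps. *)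
Definition fold_line (x : R) : R :=
  Num.max (Num.min x (Num.max (4 * c - 3 * x) (3 * x - 2 * c - 2 * d)))
          (Num.min (3 * x - 2 * c + 2 * d) (4 * c - 3 * x)).

Lemma fold_line_left x : x <= c ->
  fold_line x = Num.max x (Num.min (3 * x - 2 * c + 2 * d) (4 * c - 3 * x)).
Proof.
move=> xc; rewrite /fold_line (_ : Num.min x _ = x) //.
by apply/min_idPl; rewrite le_max; apply/orP; left; lra.
Qed.

Lemma fold_line_right x : 0 < d -> c <= x ->
  fold_line x = Num.min x (Num.max (4 * c - 3 * x) (3 * x - 2 * c - 2 * d)).
Proof.
move=> d0 cx; rewrite /fold_line (_ : Num.min (3 * x - _ + _) _ = 4 * c - 3 * x).
  by apply/max_idPl; rewrite le_min le_max lexx /= andbT; lra.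
by apply/min_idPr; lra.
Qed.

Lemma fold_line_out x : 0 < d -> d <= `|x - c| -> fold_line x = x.
Proof.
move=> d0; rewrite ler_normr => /orP[H|H].
  rewrite fold_line_right //; last by lra.
  by apply/min_idPl; rewrite le_max; apply/orP; right; lra.
rewrite fold_line_left; last by lra.
by apply/max_idPl; rewrite ge_min; apply/orP; left; lra.
Qed.

Lemma fold_line_in x : 0 < d -> `|x - c| <= d -> `|fold_line x - c| <= d.
Proof.
move=> d0; rewrite ler_norml => /andP[H1 H2]; rewrite ler_distl.
have [xc|/ltW cx] := leP x c.
  rewrite fold_line_left // le_max ge_max ge_min.
  apply/andP; split; first by apply/orP; left; lra.
  apply/andP; split; first by lra.
  have [?|?] := leP (3 * x - 2 * c + 2 * d) (c + d) => //=; lra.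
rewrite fold_line_right // le_min ge_min le_max.
apply/andP; split; last by apply/orP; left; lra.
apply/andP; split; first by lra.
have [?|?] := leP (c - d) (4 * c - 3 * x) => //=; lra.
Qed.

Lemma fold_line_center : 0 < d -> fold_line c = c.
Proof.
move=> d0; rewrite fold_line_left //; apply/max_idPl; rewrite ge_min; apply/orP; right; lra.
Qed.

(** The inverses of the two increasing laps. The middle lap is left out: the two
    others are disjoint, and stay away from c. *)
Definition branch (b : bool) (y : R) : R :=
  (y + 2 * c + (if b then 2 * d else - (2 * d))) / 3.

Lemma fold_line_branch b y : 0 < d -> `|y - c| <= d -> fold_line (branch b y) = y.
Proof.
move=> d0; rewrite ler_norml => /andP[H1 H2]; rewrite /branch; case: b.
  rewrite fold_line_right //; last by lra.
  rewrite (_ : Num.max _ _ = y); first by apply/min_idPr; lra.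
  rewrite (_ : 3 * _ - _ - _ = y); last by lra.
  by apply/max_idPr; lra.
rewrite fold_line_left; last by lra.
rewrite (_ : Num.min _ _ = y); first by apply/max_idPr; lra.
rewrite (_ : 3 * _ - _ + _ = y); last by lra.
by apply/min_idPl; lra.
Qed.

(** Inverse branches of iterates of the fold are indexed by the laps visited. *)
Lemma iter_fold_branches (w : seq bool) y : 0 < d -> `|y - c| <= d ->
  `|foldr branch y w - c| <= d /\
  iter (size w) fold_line (foldr branch y w) = y.
Proof.
move=> d0 yd; have in_window v : `|foldr branch y v - c| <= d.
  elim: v => //= a v; rewrite /branch !ler_norml; case: a; lra.
split => //; elim: w => // b w IH.
by rewrite [size _]/= iterSr /= fold_line_branch.
Qed.

Lemma branches_separated (w w' : seq bool) y y' : 0 < d ->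
  size w = size w' -> w != w' -> `|y - c| <= d -> `|y' - c| <= d ->
  2 * d / 3 ^+ size w <= `|foldr branch y w - foldr branch y' w'|.
Proof.
move=> d0; elim: w w' => [|b w IH] [|b' w'] //= [sw] ww' yd y'd.
have [bb|bb] := eqVneq b b'.
  have := IH w' sw; rewrite -bb eqseq_cons eqxx /= in ww' *.
  move=> /(_ ww' yd y'd) H; rewrite exprS.
  set u := foldr _ _ w in H *; set u' := foldr _ _ w' in H *.
  have -> : branch b u - branch b u' = (u - u') / 3 by rewrite /branch; lra.
  rewrite normrM (@ger0_norm _ (3^-1 : R)) ?invr_ge0 // invfM (mulrC (3^-1 : R)) mulrA.
  by rewrite ler_pM2r ?invr_gt0.
have d3 : 2 * d / 3 ^+ (size w).+1 <= 2 * d / 3.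
  rewrite ler_pM2l ?mulr_gt0 // lef_pV2 ?posrE ?exprn_gt0 //.
  by rewrite exprS ler_peMr // exprn_ege1 // ler1n.
apply: le_trans d3 _.
have := (iter_fold_branches w d0 yd).1; have := (iter_fold_branches w' d0 y'd).1.
set u := foldr _ _ w; set u' := foldr _ _ w'; rewrite !ler_norml ler_normr /branch.
move=> /andP[? ?] /andP[? ?].
by case: b b' bb {IH ww'} => [] [] //= _; apply/orP; [left|right]; lra.
Qed.

Lemma fold_line_continuous : continuous fold_line.
Proof.
have affine (a b : R) : continuous (fun x => a * x + b : R^o).
  by move=> x; apply: cvgD; [apply: cvgM; [exact: cvg_cst|exact: cvg_id]|exact: cvg_cst].
pose P x := - 3 * x + 4 * c; pose Q x := 3 * x + (- 2 * c - 2 * d).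
pose L x := 3 * x + (- 2 * c + 2 * d).
have -> : fold_line = (id \min (P \max Q)) \max (L \min P).
  apply/funext => x /=; rewrite /fold_line /P /Q /L.
  by congr (Num.max (Num.min _ (Num.max _ _)) (Num.min _ _)); lra.
move=> x; apply: continuous_max; apply: continuous_min; try exact: affine.
  exact: cvg_id.
by apply: continuous_max; exact: affine.
Qed.

Lemma fold_line01 x : 0 < d -> 0 <= c - d -> c + d <= 1 -> 0 <= x <= 1 -> 0 <= fold_line x <= 1.
Proof.
move=> d0 cd0 cd1 x01; have [H|/ltW H] := leP d `|x - c|; first by rewrite fold_line_out.
by have := fold_line_in d0 H; rewrite ler_norml; lra.
Qed.

Lemma fold_line_lt x t : (fold_line x < t) =
  ((x < t) || ((4 * c - 3 * x < t) && (3 * x - 2 * c - 2 * d < t))) &&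
  ((3 * x - 2 * c + 2 * d < t) || (4 * c - 3 * x < t)).
Proof. by rewrite /fold_line gt_max !gt_min gt_max. Qed.

(** The preimage of [0, t[ consists of at most two intervals, one in the first lap
    and one in the union of the two others, of total length t. *)
Lemma fold_line_ray t : 0 < d -> 0 <= c - d -> c + d <= 1 -> 0 <= t <= 1 ->
  mu ([set x | fold_line x < t] `&` `[0, 1]) = t%:E.
Proof.
move=> d0 cd0 cd1 /andP[t0 t1]; have [t_in|t_out] := boolP (c - d < t <= c + d).
  set p := (t + 2 * c - 2 * d) / 3; set q := (4 * c - t) / 3.
  set r := (t + 2 * c + 2 * d) / 3.
  have -> : [set x | fold_line x < t] `&` `[0, 1] = `[0, p[%classic `|` `]q, r[%classic.
    have /andP[tl tr] := t_in.
    apply/seteqP; split => x /=; rewrite fold_line_lt !in_itv /= /p /q /r.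
      move=> [/andP[/orP[A|/andP[A B]] /orP[D|D]] /andP[x0 x1]].
      - by left; lra.
      - by right; lra.
      - by left; lra.
      - by right; lra.
    move=> [/andP[x0 xp]|/andP[qx xr]].
      have -> : x < t by lra.
      have -> : 3 * x - 2 * c + 2 * d < t by lra.
      by split=> //; lra.
    have -> : 4 * c - 3 * x < t by lra.
    have -> : 3 * x - 2 * c - 2 * d < t by lra.
    by rewrite !orbT; split=> //; lra.
  rewrite measureU //; last first.
    apply/seteqP; split => // x /=; rewrite !in_itv /= /p /q => -[]; lra.
  rewrite [X in (X + _)%E]lebesgue_measure_itv [X in (_ + X)%E]lebesgue_measure_itv /= !lte_fin.
  have -> : 0 < p by rewrite /p; lra.
  have -> : q < r by rewrite /q /r; lra.
  by rewrite -!EFinB -EFinD; congr EFin; rewrite /p /q /r; lra.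
have -> : [set x | fold_line x < t] `&` `[0, 1] = `[0, t[%classic.
  apply/seteqP; split => x /=; rewrite fold_line_lt !in_itv /=.
    move=> [/andP[/orP[A|/andP[A B]] _] /andP[x0 x1]]; first by rewrite x0.
    have tr : c + d < t by move: t_out; rewrite negb_and -leNgt -ltNge => /orP[]; lra.
    by lra.
  move=> /andP[x0 xt]; rewrite xt /= x0; split; last by lra.
  have [//|L] := ltP (3 * x - 2 * c + 2 * d) t.
  by move: t_out; rewrite negb_and -leNgt -ltNge => /orP[] ?; lra.
rewrite lebesgue_measure_itv /= lte_fin; case: ltP => [_|t0']; first by rewrite sube0.
by congr EFin; lra.
Qed.

End Fold.

(** * Measure-preserving maps *)

Section Preserving.
Context {R : realType}.
Notation I := (unit_interval R).
Notation mu := (@lebesgue_measure R).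
Implicit Types (f g : I -> I).

(** The maps of C(lambda), unbundled. *)
Definition preserving f := continuous f /\
  forall A, borel01 A -> lambda01 A = lambda01 (f @^-1` A).

Lemma preserving_comp f g : preserving f -> preserving g -> preserving (f \o g).
Proof.
move=> [cf pf] [cg pg]; split.
  by move=> x; apply: continuous_comp; [exact: cg|exact: cf].
move=> A bA; apply: etrans (pf A bA) _.
exact: pg (borel01_preimage cf bA).
Qed.

Lemma preserving_iter f n : preserving f -> preserving (iter n f).
Proof.
move=> pf; elim: n => [|n IH]; last exact: (preserving_comp pf IH).
by split=> // x; exact: cvg_id.
Qed.

Lemma preserving_ray f t : preserving f -> 0 <= t <= 1 ->
  mu ([set x | extend f x < t] `&` `[0, 1]) = t%:E.
Proof.
move=> [cf pf] /andP[t0 t1]; pose A : set I := [set y | (set_val y : R) < t].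
have oA : open A.
  have -> : A = set_val @^-1` `]-oo, t[ by apply/seteqP; split => x; rewrite /A /= in_itv.
  by apply: open_comp; [move=> x _; exact: set_val_continuous|exact: interval_open].
have bA : borel01 A by apply: sub_sigma_algebra.
have := pf A bA; rewrite lambda01_preimage lambda01E.
have -> : extend f @^-1` (clamp @^-1` A) = [set x | extend f x < t].
  by apply/seteqP; split => x /=; rewrite /A /= set_val_clamp ?extend01.
move=> <-; have -> : clamp @^-1` A `&` `[0, 1] = `[0, t[%classic.
  apply/seteqP; split => x /=; rewrite !in_itv /=.
    by move=> [Ax x01]; move: Ax; rewrite /A /= set_val_clamp // => ->; case/andP: x01 => ->.
  move=> /andP[x0 xt]; have x01 : 0 <= x <= 1 by lra.
  by rewrite /A /= set_val_clamp.
rewrite lebesgue_measure_itv /= lte_fin; case: ltP => [_|t0']; first by rewrite sube0.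
by congr EFin; lra.
Qed.

Lemma measurable_ray f t : continuous f ->
  measurable ([set x | extend f x < t] `&` `[0, 1] : set R).
Proof.
move=> cf; apply: measurableI => //; apply: open_measurable.
have -> : [set x | extend f x < t] = extend f @^-1` `]-oo, t[.
  by apply/seteqP; split => x; rewrite /= in_itv.
by apply: open_comp; [move=> x _; exact: extend_continuous|exact: interval_open].
Qed.

Definition fold_unit (c d : R) (x : I) : I := clamp (fold_line c d (set_val x)).

Lemma set_val_fold c d x : 0 < d -> 0 <= c - d -> c + d <= 1 ->
  set_val (fold_unit c d x) = fold_line c d (set_val x).
Proof. by move=> d0 cd0 cd1; rewrite set_val_clamp // fold_line01 // set_val01. Qed.

Lemma preserving_fold c d : 0 < d -> 0 <= c - d -> c + d <= 1 ->
  preserving (fold_unit c d).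
Proof.
move=> d0 cd0 cd1; have cfold : continuous (fold_unit c d).
  move=> x; apply: (@continuous_comp _ _ _ (fold_line c d \o set_val) clamp).
    apply: continuous_comp; first exact: set_val_continuous.
    exact: fold_line_continuous.
  exact: clamp_continuous.
split=> //; apply: preserving_of_rays => // t t01.
rewrite -(fold_line_ray d0 cd0 cd1 t01); congr (mu _).
apply/seteqP; split => x /= [+ x01]; move: (x01); rewrite in_itv /= => x01'.
  by rewrite /extend set_val_fold // set_val_clamp.
by rewrite /extend set_val_fold // set_val_clamp.
Qed.

(** The image of the window is an interval that contains c and, since its preimage
    contains the window, has length at least 2 d: it cannot stop short of both
    c - d and c + d. The boolean b is true when it reaches c + d. *)
Lemma preserving_expands f c d : preserving f ->
  0 < d -> 0 <= c - d -> c + d <= 1 -> extend f c = c ->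
  exists b : bool, forall y, (if b then c <= y <= c + d else c - d <= y <= c) ->
    exists2 z, `|z - c| <= d & extend f z = y.
Proof.
move=> pf d0 cd0 cd1 fc; have [cf _] := pf; have cF := extend_continuous cf.
have cd : c - d <= c + d by lra.
have cW : {within `[c - d, c + d], continuous (extend f)} by exact: continuous_subspaceT.
have [q] := EVT_max cd cW; rewrite in_itv /= => qW qmax.
have [p] := EVT_min cd cW; rewrite in_itv /= => pW pmin.
have winI z w : c - d <= w <= c + d -> between c w z -> `|z - c| <= d.
  by move=> wW; rewrite /between ge_min le_max ler_norml => /andP[/orP[?|?] /orP[?|?]]; lra.
have [Mq|Mq] := leP (c + d) (extend f q).
  exists true => y /andP[cy yd].
  have [|z zc <-] := @IVT_between _ _ c q y cF; first by rewrite fc; lra.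
  by exists z => //; exact: winI zc.
have [mp|mp] := leP (extend f p) (c - d).
  exists false => y /andP[dy yc].
  have [|z zc <-] := @IVT_between _ _ p c y cF; first by rewrite fc; lra.
  by exists z => //; apply: (winI _ p) => //; rewrite betweenC.
exfalso; set m := extend f p in pmin mp; set M := extend f q in qmax Mq.
have /andP[m0 m1] : 0 <= m <= 1 by exact: extend01.
have /andP[M0 M1] : 0 <= M <= 1 by exact: extend01.
(* M' lies strictly between M and c + d, so that the window is in the preimage of
   the open ray ]-oo, M'[. *)
pose M' := (M + (c + d)) / 2.
have M'01 : 0 <= M' <= 1 by rewrite /M'; lra.
have m01 : 0 <= m <= 1 by lra.
pose A t := [set x | extend f x < t] `&` `[0, 1] : set R.
pose W : set R := `[c - d, c + d]%classic.
have : (mu (A m `|` W) <= mu (A M'))%E.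
  apply: le_measure; rewrite ?inE.
  - by apply: measurableU; [exact: (measurable_ray m cf)|exact: measurable_itv].
  - exact: (measurable_ray M' cf).
  - move=> x [[/= fx x01]|].
      split=> //=; have := qmax p; rewrite in_itv /= => /(_ pW).
      by rewrite -/m /M'; lra.
    rewrite /W /= in_itv /= => xW; split; last by rewrite /= in_itv /=; lra.
    by have := qmax x; rewrite in_itv /= => /(_ xW); rewrite /= /M'; lra.
have muW : mu W = (2 * d)%:E.
  rewrite lebesgue_measure_itv /= lte_fin (_ : c - d < c + d); last by lra.
  by rewrite -EFinB; congr EFin; lra.
have -> : mu (A m `|` W) = (mu (A m) + mu W)%E.
  apply: measureU; [exact: (measurable_ray m cf)|exact: measurable_itv|].
  apply/seteqP; split => // x /= [[fx _]]; rewrite /W /= in_itv /= => xW.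
  by have := pmin x; rewrite in_itv /= => /(_ xW); rewrite leNgt fx.
by rewrite muW /A !preserving_ray // -EFinD lee_fin /M'; lra.
Qed.

End Preserving.

(** * An interior fixed point *)

Section FixedPoint.
Context {R : realType}.
Notation I := (unit_interval R).
Notation mu := (@lebesgue_measure R).

(** Otherwise f is on one side of the identity on ]0, 1[, say f(x) > x. Then the
    preimage of [0, 1/2[ is, up to the point 1, in [0, 1/2[, and by continuity of
    f at 1/2 it misses a neighbourhood of 1/2, so its measure is less than 1/2. *)
Lemma interior_fixed_point (f : I -> I) : preserving f ->
  exists2 c : R, 0 < c < 1 & extend f c = c.
Proof.
move=> pf; have [cf _] := pf; have cF := extend_continuous cf; set F := extend f.
have cG : continuous (fun x => F x - x).
  by move=> x; apply: cvgB; [exact: cF|exact: cvg_id].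
have fix_between a b : 0 < a < 1 -> 0 < b < 1 -> F a <= a -> b <= F b ->
    exists2 c : R, 0 < c < 1 & F c = c.
  move=> a01 b01 Fa Fb.
  have [|c cab /eqP Fc] := @IVT_between _ _ a b 0 cG; first by lra.
  exists c; last by apply/eqP; rewrite -subr_eq0.
  move: cab; rewrite /between ge_min le_max => /andP[/orP[?|?] /orP[?|?]]; lra.
have h01 : 0 <= (1 / 2 : R) <= 1 by lra.
have ray := preserving_ray pf h01.
have half01 : 0 < (1 / 2 : R) < 1 by lra.
pose A := [set x | F x < 1 / 2] `&` `[0, 1] : set R.
have mA : measurable A by exact: measurable_ray.
have [Fh|Fh] := leP (F (1 / 2)) (1 / 2).
  have [Fh'|Fh'] := leP (1 / 2) (F (1 / 2)); first exact: (fix_between _ _ half01 half01).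
  have [[x x01 Fx]|below] := pselect (exists2 x, 0 < x < 1 & x <= F x).
    exact: (fix_between _ _ half01 x01).
  exfalso.
  have /cvgrPdist_lt/(_ (1 / 2 - F (1 / 2))) := cF (1 / 2).
  rewrite subr_gt0 => /(_ Fh')/nbhs_ballP[e0 /= e00 H].
  pose e := Num.min e0 (1 / 4).
  have e_gt0 : 0 < e by rewrite lt_min e00; lra.
  have [e_e0 e4] : e <= e0 /\ e <= 1 / 4 by rewrite /e !ge_min !lexx orbT.
  have : (mu `]0%R, (1 / 2 + e)%R[ <= mu A)%E.
    apply: le_measure; rewrite ?inE //.
    move=> x /=; rewrite in_itv /= => /andP[x0 xe]; split; last by rewrite /= in_itv /=; lra.
    have Fx : F x < x by rewrite ltNge; apply/negP => Fx; apply: below; exists x => //; lra.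
    have [xh|hx] := leP x (1 / 2); first by rewrite /=; lra.
    have xh' : `|1 / 2 - x| < e0 by rewrite ltr_norml; lra.
    by have := H x xh'; rewrite /= ltr_norml -/F; lra.
  rewrite ray lebesgue_measure_itv /= lte_fin (_ : 0 < 1 / 2 + e); last by lra.
  by rewrite sube0 lee_fin; lra.
have [[x x01 Fx]|above] := pselect (exists2 x, 0 < x < 1 & F x <= x).
  exact: (fix_between _ _ x01 half01 Fx (ltW Fh)).
exfalso.
have /cvgrPdist_lt/(_ (F (1 / 2) - 1 / 2)) := cF (1 / 2).
rewrite subr_gt0 => /(_ Fh)/nbhs_ballP[e0 /= e00 H].
pose e := Num.min e0 (1 / 4).
have e_gt0 : 0 < e by rewrite lt_min e00; lra.
have [e_e0 e4] : e <= e0 /\ e <= 1 / 4 by rewrite /e !ge_min !lexx orbT.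
pose B : set R := `[0, 1 / 2 - e]%classic.
have : (mu A <= mu (B `|` [set 1%R]))%E.
  apply: le_measure; rewrite ?inE; first exact: mA.
    by apply: measurableU; [exact: measurable_itv|exact: measurable_set1].
  move=> x [/= Fx]; rewrite in_itv /= => x01; rewrite /B /= in_itv /=.
  have [x1|x1] := leP 1 x; first by right; lra.
  left; have [xl|xl] := leP x (1 / 2 - e); first by lra.
  have Fxx : x < F x by rewrite ltNge; apply/negP => Fx'; apply: above; exists x => //; lra.
  have xh : `|1 / 2 - x| < e0 by rewrite ltr_norml; lra.
  by have := H x xh; rewrite /= ltr_norml -/F; lra.
have -> : mu (B `|` [set 1%R]) = (mu B + mu [set 1%R])%E.
  apply: measureU; [exact: measurable_itv|exact: measurable_set1|].
  apply/seteqP; split => // x /= []; rewrite /B /= in_itv /= => xB x1.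
  by rewrite x1 in xB; lra.
rewrite ray lebesgue_measure_set1 adde0 lebesgue_measure_itv /= lte_fin.
rewrite (_ : 0 < 1 / 2 - e); last by lra.
by rewrite sube0 lee_fin; lra.
Qed.

End FixedPoint.

(** * Infinite entropy by repeated folding *)

Section Perturbation.
Context {R : realType}.
Notation I := (unit_interval R).
Notation mu := (@lebesgue_measure R).
(* D k G b chooses the radius of a window, at most b, that G sends to within
   e / 2 ^ k of c. *)
Variables (f : I -> I) (c e : R) (D : nat -> (I -> I) -> R -> R).
Hypotheses (pf : preserving f) (c01 : 0 < c < 1) (fc : extend f c = c) (e0 : 0 < e).
Hypothesis radius : forall k G b, preserving G -> extend G c = c -> 0 < b ->
  [/\ 0 < D k G b <= b, 0 <= c - D k G b, c + D k G b <= 1 &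
      forall x, `|set_val x - c| <= D k G b -> `|set_val (G x) - c| <= e / 2 ^+ k].

(** The k-th map and the radius of its window, over which the next map is folded
    k + 1 times. The factor 1 / 4 puts each window inside the middle third of
    the previous one. *)
Fixpoint stage k : (I -> I) * R :=
  if k is j.+1 then
    let G := (stage j).1 \o iter j.+1 (fold_unit c (stage j).2) in
    (G, D j.+1 G ((stage j).2 / 4))
  else (f, D 0 f 1).

Notation G k := (stage k).1.
Notation delta k := (stage k).2.

Lemma set_val_inj (x y : I) : set_val x = set_val y -> x = y.
Proof. exact: val_inj. Qed.

Lemma set_val_center : set_val (clamp c : I) = c.
Proof. by rewrite set_val_clamp //; have := c01; lra. Qed.

Lemma iter_fold_val d n x : 0 < d -> 0 <= c - d -> c + d <= 1 ->
  set_val (iter n (fold_unit c d) x) = iter n (fold_line c d) (set_val x).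
Proof. by move=> *; elim: n => //= n <-; rewrite set_val_fold. Qed.

Lemma stageP k : [/\ preserving (G k), extend (G k) c = c,
   [/\ 0 < delta k, 0 <= c - delta k & c + delta k <= 1] &
   forall x, `|set_val x - c| <= delta k -> `|set_val (G k x) - c| <= e / 2 ^+ k].
Proof.
elim: k => [|k [pG Gc [d0 cd0 cd1] _]] /=.
  by have [/andP[d0 _] cd0 cd1 b] := radius 0 pf fc ltr01.
set G' := _ \o _; have pG' : preserving G'.
  by apply: preserving_comp => //; apply: preserving_iter; exact: preserving_fold.
have G'c : extend G' c = c.
  rewrite -[RHS]Gc /extend /G' /=; congr (set_val (G k _)); apply: set_val_inj.
  have := iter_fold_val k.+1 (clamp c) d0 cd0 cd1; rewrite set_val_center /= => ->.
  by rewrite iter_fix fold_line_center.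
have d4 : 0 < delta k / 4 by rewrite divr_gt0.
by have [/andP[? _] ? ? ?] := radius k.+1 pG' G'c d4.
Qed.

Lemma delta_gt0 k : 0 < delta k.
Proof. by have [_ _ []] := stageP k. Qed.

Lemma deltaS k : delta k.+1 <= delta k / 4.
Proof.
have d4 : 0 < delta k / 4 by rewrite divr_gt0 // delta_gt0.
have [pG Gc _ _] := stageP k.+1.
by have [/andP[]] := radius k.+1 pG Gc d4.
Qed.

Lemma delta_le j k : (j <= k)%N -> delta k <= delta j.
Proof.
move=> /subnKC <-; elim: (k - j)%N => [|n IH]; first by rewrite addn0.
rewrite addnS; apply: le_trans (deltaS _) (le_trans _ IH).
by have := delta_gt0 (j + n); lra.
Qed.

Lemma delta_small (b : R) : 0 < b -> exists k, delta k < b.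
Proof.
move=> b0; have geo k : delta k <= (1 / 4) ^+ k.
  elim: k => [|k IH].
    by have [/andP[_ ?] _ _ _] := radius 0 pf fc ltr01; rewrite expr0.
  by apply: le_trans (deltaS k) _; rewrite exprS; lra.
have : (fun n => (1 / 4 : R) ^+ n) @ \oo --> 0.
  by apply: cvg_expr; rewrite ger0_norm; lra.
move=> /cvgrPdist_lt/(_ _ b0)[k _ /(_ k (leqnn k))].
rewrite sub0r normrN ger0_norm ?exprn_ge0 ?divr_ge0 //.
by move=> kb; exists k; exact: le_lt_trans (geo k) kb.
Qed.

Lemma eventually_small (b : R) : 0 < b -> exists k, e / 2 ^+ k < b.
Proof.
move=> b0; have : (fun n => e / 2 ^+ n) @ \oo --> 0.
  rewrite -[X in _ --> X](mulr0 e); apply: cvgM; first exact: cvg_cst.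
  under eq_fun do rewrite -exprVn.
  by apply: cvg_expr; rewrite ger0_norm; lra.
move=> /cvgrPdist_lt/(_ _ b0)[k _ /(_ k (leqnn k))].
rewrite sub0r normrN ger0_norm; last by rewrite divr_ge0 ?exprn_ge0 // ltW.
by exists k.
Qed.

Lemma stageS k x : G k.+1 x = G k (iter k.+1 (fold_unit c (delta k)) x).
Proof. by []. Qed.

Lemma iter_fold_out k n x : delta k <= `|set_val x - c| ->
  iter n (fold_unit c (delta k)) x = x.
Proof.
have [_ _ [d0 cd0 cd1] _] := stageP k => xc; apply: set_val_inj.
by rewrite iter_fold_val // iter_fix // fold_line_out.
Qed.

Lemma iter_fold_in k n x : `|set_val x - c| <= delta k ->
  `|set_val (iter n (fold_unit c (delta k)) x) - c| <= delta k.
Proof.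
have [_ _ [d0 cd0 cd1] _] := stageP k => xc; rewrite iter_fold_val //.
by elim: n => //= n IH; exact: fold_line_in.
Qed.

Lemma stage_out j k x : (j <= k)%N -> delta j <= `|set_val x - c| -> G k x = G j x.
Proof.
move=> /subnKC <- xc; elim: (k - j)%N => [|n IH]; first by rewrite addn0.
rewrite addnS stageS iter_fold_out //; apply: le_trans xc; apply: delta_le.
exact: leq_addr.
Qed.

Lemma stage_in j k x : (j <= k)%N -> `|set_val x - c| <= delta j ->
  `|set_val (G k x) - c| <= e / 2 ^+ j.
Proof.
move=> /subnKC <-; elim: (k - j)%N x => [|n IH] x xc.
  by rewrite addn0; have [_ _ _] := stageP j; apply.
rewrite addnS stageS; apply: IH; have [xk|/ltW xk] := leP (delta (j + n)) `|set_val x - c|.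
  by rewrite iter_fold_out.
by apply: le_trans (iter_fold_in _ xk) _; apply: delta_le; exact: leq_addr.
Qed.

(** The stages are eventually constant at each point: off c because the windows
    shrink to c, and at c because all stages fix c. *)
Lemma stage_limit : exists g : I -> I,
  (forall k x, delta k <= `|set_val x - c| -> g x = G k x) /\
  (forall k x, `|set_val x - c| <= delta k -> `|set_val (g x) - c| <= e / 2 ^+ k).
Proof.
have /choice[g gP] : forall x, exists y, exists k, forall j, (k <= j)%N -> G j x = y.
  move=> x; have [xc|xc] := eqVneq (set_val x) c.
    exists (clamp c), 0 => j _; apply: set_val_inj; rewrite set_val_center.
    have [_ Gc _ _] := stageP j; rewrite -[RHS]Gc /extend.
    by rewrite -xc clampK.
  have [|k kx] := @delta_small `|set_val x - c|; first by rewrite normr_gt0 subr_eq0.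
  by exists (G k x), k => j kj; apply: stage_out kj (ltW kx).
exists g; split => k x xc; have [n gn] := gP x.
  by rewrite -(gn (maxn n k)) ?leq_maxl // (stage_out (leq_maxr n k)).
by rewrite -(gn (maxn n k)) ?leq_maxl //; apply: stage_in => //; exact: leq_maxr.
Qed.

Section Limit.
Variable g : I -> I.
Hypothesis g_out : forall k x, delta k <= `|set_val x - c| -> g x = G k x.
Hypothesis g_in : forall k x,
  `|set_val x - c| <= delta k -> `|set_val (g x) - c| <= e / 2 ^+ k.

Lemma limit_center x : set_val x = c -> set_val (g x) = c.
Proof.
move=> xc; apply/eqP; rewrite -subr_eq0 -normr_le0; apply/ler_addgt0Pr => b b0.
have [k kb] := eventually_small b0; rewrite add0r; apply: le_trans (ltW kb).
by apply: g_in; rewrite xc subrr normr0 ltW // delta_gt0.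
Qed.

(** Off c, g coincides locally with a stage; at c, the windows are sent to
    shrinking neighbourhoods of c. *)
Lemma limit_continuous : continuous g.
Proof.
move=> x; apply/unit_continuousP => b b0; have [xc|xc] := eqVneq (set_val x) c.
  have [k kb] := eventually_small b0; exists (delta k); first exact: delta_gt0.
  move=> y; rewrite (limit_center xc) xc distrC => yd.
  by rewrite distrC; apply: le_lt_trans (g_in (ltW yd)) kb.
have [|k kx] := @delta_small `|set_val x - c|; first by rewrite normr_gt0 subr_eq0.
have [[cG _] _ _ _] := stageP k.
have [d d0 Gd] := (unit_continuousP _ _).1 (cG x) b b0.
exists (Num.min d (`|set_val x - c| - delta k)); first by rewrite lt_min d0 subr_gt0.
move=> y; rewrite lt_min => /andP[xyd xy]; rewrite (g_out (ltW kx)) (@g_out k y).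
  exact: Gd.
have := ler_distD (set_val y) (set_val x) c; lra.
Qed.

(** The preimages of a ray by g and by stage k differ only inside the k-th window,
    whose length 2 delta_k tends to 0. *)
Lemma limit_preserving : preserving g.
Proof.
split; first exact: limit_continuous.
apply: preserving_of_rays; first exact: limit_continuous.
move=> t t01; pose A (h : I -> I) : set R := [set x | extend h x < t] `&` `[0, 1].
have mA : measurable (A g) by exact: measurable_ray limit_continuous.
pose J k : set R := `[c - delta k, c + delta k]%classic.
have muJ k : mu (J k) = (2 * delta k)%:E.
  have dk := delta_gt0 k.
  rewrite lebesgue_measure_itv /= lte_fin (_ : c - _ < c + _); last by lra.
  by rewrite -EFinB; congr EFin; lra.
have muA k : mu (A (G k)) = t%:E.
  by have [pG _ _ _] := stageP k; exact: preserving_ray.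
have mAk k : measurable (A (G k)).
  by have [[cG _] _ _ _] := stageP k; exact: measurable_ray.
have inJ k x : 0 <= x <= 1 -> ~ J k x -> extend g x = extend (G k) x.
  move=> x01; rewrite /J /= in_itv /= => nJ; rewrite /extend (g_out (k := k)) //.
  rewrite set_val_clamp // leNgt; apply/negP; rewrite ltr_distl => ?.
  by apply: nJ; lra.
have mJ k : measurable (J k) by exact: measurable_itv.
have cover (X Y Z : set R) : measurable X -> measurable Y -> measurable Z ->
    X `<=` Y `|` Z -> (mu X <= mu Y + mu Z)%E.
  move=> mX mY mZ XYZ; apply: (@le_trans _ _ (mu (Y `|` Z))); last exact: measureU2.
  by apply: le_measure => //; rewrite inE //; exact: measurableU.
have AJ k : (mu (A g) <= mu (A (G k)) + mu (J k))%E.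
  apply: cover => // x [/= gx]; rewrite in_itv /= => x01.
  have [Jx|nJx] := pselect (J k x); first by right.
  by left; split; rewrite /= ?in_itv // -inJ.
have JA k : (mu (A (G k)) <= mu (A g) + mu (J k))%E.
  apply: cover => // x [/= gx]; rewrite in_itv /= => x01.
  have [Jx|nJx] := pselect (J k x); first by right.
  by left; split; rewrite /= ?in_itv // (inJ k).
have small b : 0 < b -> exists k, 2 * delta k < b.
  move=> b0; have [|k kb] := @delta_small (b / 2); first by rewrite divr_gt0.
  by exists k; lra.
apply/eqP; rewrite eq_le; apply/andP; split; apply/lee_addgt0Pr => b /small[k kb].
  apply: le_trans (AJ k) _; rewrite muA muJ -!EFinD lee_fin; lra.
rewrite -(muA k); apply: le_trans (JA k) _; apply: leeD => //.
by rewrite muJ lee_fin ltW.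
Qed.

Lemma limit_close x : `|set_val (f x) - set_val (g x)| <= 2 * e.
Proof.
have ge0 := e0; have [xc|/ltW xc] := leP (delta 0) `|set_val x - c|.
  by rewrite (g_out xc) subrr normr0; lra.
have gx := g_in xc; have fx := @stage_in 0 0 x (leqnn 0) xc.
rewrite expr0 divr1 in gx fx.
have := ler_distD c (set_val (f x)) (set_val (g x)).
by rewrite (distrC c); move: fx => /=; lra.
Qed.

(** Stage k maps its window over one of its halves, on the side given by b, and
    folding k + 1 times maps each interval K w over the window. The first letter
    of the word b :: w puts K w in the half b and off the middle third, hence off
    the later windows, so that there g is stage k + 1. *)
Lemma limit_horseshoe k : ((ln (2 ^ k)%:R)%:E <= topological_entropy g)%E.
Proof.
have [pG Gc [d0 cd0 cd1] _] := stageP k; set d := delta k in d0 cd0 cd1 *.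
have [b bP] := preserving_expands pG d0 cd0 cd1 Gc.
pose side : set I := [set x | if b then c <= set_val x <= c + d else c - d <= set_val x <= c].
pose K (w : k.-tuple bool) : set I := [set x | exists2 y, `|y - c| <= d &
  set_val x = foldr (branch c d) y (b :: w)].
have K_out w x : K w x -> d / 3 <= `|set_val x - c| <= d.
  move=> [y yd ->] /=; have [] := iter_fold_branches w d0 yd.
  set u := foldr _ _ _; rewrite /branch !ler_norml => /andP[? ?] _.
  by rewrite ler_normr; case: (b); apply/andP; split; try (by apply/andP; split; lra);
    apply/orP; [left|right]; lra.
have K_side w : K w `<=` side.
  move=> x [y yd] /= xE; have [] := iter_fold_branches w d0 yd.
  rewrite /side /= xE; set u := foldr _ _ _; rewrite /branch !ler_norml => /andP[? ?] _.
  by case: (b); apply/andP; split; lra.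
have card : #|{: k.-tuple bool}| = (2 ^ k)%N by rewrite card_tuple card_bool.
have -> : ln (2 ^ k)%:R = ln #|{: k.-tuple bool}|%:R / 1%:R :> R by rewrite card divr1.
apply: (@horseshoe_entropy _ _ g _ 1 side K (d / 3 ^+ k.+1)) => //.
- by rewrite divr_gt0 // exprn_gt0.
- by rewrite card expn_gt0.
- exists (clamp c); rewrite /side /= set_val_center; case: (b); lra.
- move=> w y /bP[z zd Gz].
  have [wd wz] := iter_fold_branches (b :: w) d0 zd.
  have w01 : 0 <= foldr (branch c d) z (b :: w) <= 1.
    by move: wd; rewrite ler_norml; lra.
  have Kx : K w (clamp (foldr (branch c d) z (b :: w))).
    by exists z => //; rewrite set_val_clamp.
  exists (clamp (foldr (branch c d) z (b :: w))) => //=.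
  rewrite (@g_out k.+1); last first.
    have /andP[xd _] := K_out _ _ Kx; apply: le_trans xd.
    by apply: le_trans (deltaS k) _; rewrite -/d; lra.
  rewrite stageS -/d; apply: set_val_inj; rewrite -Gz /extend; congr (set_val (G k _)).
  apply: set_val_inj; rewrite iter_fold_val // set_val_clamp //.
  have z01 : 0 <= z <= 1 by move: zd; rewrite ler_norml; lra.
  rewrite -[k.+1](_ : size (b :: w) = _) ?wz ?set_val_clamp //=.
  by rewrite size_tuple.
- move=> w w' x x' ww' [y yd xE] [y' y'd x'E]; exists 0 => //=.
  rewrite mdist_unit xE x'E.
  have sw : size (b :: w) = size (b :: w') by rewrite /= !size_tuple.
  have bww' : b :: w != b :: w' by rewrite eqseq_cons eqxx.
  apply: lt_le_trans (branches_separated d0 sw bww' yd y'd).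
  by rewrite /= size_tuple ltr_pM2r ?invr_gt0 ?exprn_gt0 //; lra.
Qed.

Lemma limit_entropy : topological_entropy g = +oo%E.
Proof.
apply: eqy_ln => k; apply: le_trans (limit_horseshoe k.+2).
rewrite lee_fin ler_ln ?posrE ?ltr0n ?expn_gt0 // ler_nat.
exact: ltnW (ltn_expl _ _).
Qed.

End Limit.
End Perturbation.

Lemma perturb_infinite_entropy (R : realType) (f : unit_interval R -> unit_interval R)
    (eps : R) : preserving f -> 0 < eps ->
  exists g, [/\ preserving g, topological_entropy g = +oo%E &
    forall x, `|set_val (f x) - set_val (g x)| <= eps].
Proof.
move=> pf eps0; have [c c01 fc] := interior_fixed_point pf.
pose e := eps / 2; have e0 : 0 < e by rewrite divr_gt0.
have /choice[D DP] : forall p : nat * (unit_interval R -> unit_interval R) * R, exists d : R,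
    preserving p.1.2 -> extend p.1.2 c = c -> 0 < p.2 ->
    [/\ 0 < d <= p.2, 0 <= c - d, c + d <= 1 &
      forall x, `|set_val x - c| <= d -> `|set_val (p.1.2 x) - c| <= e / 2 ^+ p.1.1].
  move=> [[k G] b] /=; have [[[[cG pG] Gc] b0]|nH] :=
      pselect ((preserving G /\ extend G c = c) /\ 0 < b); last first.
    by exists 0 => pG Gc b0; exfalso; apply: nH.
  have ek : 0 < e / 2 ^+ k by rewrite divr_gt0 // exprn_gt0.
  have [r r0 Gr] := (unit_continuousP _ _).1 (cG (clamp c)) _ ek.
  exists (Num.min (Num.min b (r / 2)) (Num.min c (1 - c))) => _ _ _.
  set d := Num.min _ _.
  have [db dr dc dc1] : [/\ d <= b, d <= r / 2, d <= c & d <= 1 - c].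
    by rewrite /d !ge_min !lexx !orbT.
  have d0 : 0 < d by rewrite /d !lt_min b0; lra.
  split; [by rewrite d0|lra|lra|].
  move=> x xd; have cE : set_val (clamp c : unit_interval R) = c.
    by rewrite set_val_clamp //; lra.
  rewrite -[X in _ - X]Gc distrC /extend; apply/ltW/Gr.
  by rewrite cE distrC; lra.
have radius k G b := DP (k, G, b).
have [g [g_out g_in]] := stage_limit (D := fun k G b => D (k, G, b)) pf c01 fc radius.
exists g; split.
- exact: (limit_preserving pf c01 fc e0 radius g_out g_in).
- exact: (limit_entropy pf c01 fc radius g_out).
- move=> x; apply: le_trans (limit_close pf c01 fc e0 radius g_out g_in x) _.
  by rewrite /e; lra.
Qed.

(** * The metric of uniform convergence *)

Section ClambdaMetric.
Context {R : realType}.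
Implicit Types f g : Clambda R.

Lemma le_rho f g x : `|set_val (f x) - set_val (g x)| <= rho f g.
Proof.
apply: sup_ubound; last by exists x.
exists 1 => _ [y _ <-]; have := set_val01 (f y); have := set_val01 (g y).
by rewrite ler_norml; lra.
Qed.

Lemma rho_le f g e : (forall x, `|set_val (f x) - set_val (g x)| <= e) -> rho f g <= e.
Proof.
move=> fge; apply: ge_sup => [|_ [x _ <-]//].
by exists `|set_val (f (clamp 0)) - set_val (g (clamp 0))|, (clamp 0).
Qed.

Lemma ball_rho f e g : ball f e g <-> rho f g < e.
Proof. by rewrite ballEmdist. Qed.

Lemma Clambda_preserving_fun f : preserving f.
Proof. by case: f. Qed.

End ClambdaMetric.

Theorem proposition26 (R : realType) :
  dense [set f : Clambda R | topological_entropy f = +oo%E] /\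
  Gdelta [set f : Clambda R | topological_entropy f = +oo%E].
Proof.
split.
  move=> O [f Of] oO.
  have /nbhs_ballP[r /= r0 rO] : nbhs f O by exact: open_nbhs_nbhs.
  have r2 : 0 < r / 2 by rewrite divr_gt0.
  have [g [[cg pg] hg fg]] := perturb_infinite_entropy (Clambda_preserving_fun f) r2.
  exists (MkClambda cg pg); split => //; apply/rO/ball_rho.
  by apply: le_lt_trans (@rho_le _ f (MkClambda cg pg) _ fg) _; lra.
pose H n := [set f : Clambda R | (ln n.+2%:R)%:E <= topological_entropy f]%E.
exists (fun n => (H n)°) => [n|]; first exact: open_interior.
apply/seteqP; split => f /=.
  move=> hf n _; have [cf _] := Clambda_preserving_fun f.
  have [d d0 close] := robust_entropy cf (ltn0Sn n.+1 : (1 < n.+2)%N) hf.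
  apply/nbhs_ballP; exists d => // g /ball_rho fg.
  apply: close => [|x]; first by have [] := Clambda_preserving_fun g.
  exact: le_lt_trans (le_rho f g x) fg.
by move=> Hf; apply: eqy_ln => k; exact: (interior_subset (Hf k I)).
Qed.
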